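(* Let $L\ne\{0,1\}$ be a C-lattice domain in which every element is a join of principal elements, and suppose $L$ has finite character. The following are equivalent: (i) $L$ is sharp; (ii) for every maximal element $m$ of $L$, the localization $L_m$ is isomorphic to $\mathbb{Z}_-$ or to $\mathbb{R}_1$.
   Context: A multiplicative lattice is a complete lattice $(L,\le)$ with bottom $0$ and top $1$ which is also a commutative monoid with identity $1$ such that $a(\bigvee_\alpha b_\alpha)=\bigvee_\alpha(ab_\alpha)$ for all $a,b_\alpha\in L$. For $x,y\in L$, $(y:x)=\bigvee\{a\in L: ax\le y\}$. An element $c$ is compact if $c\le\bigvee S$ implies $c\le\bigvee T$ for some finite $T\subseteq S$. A C-lattice is a multiplicative lattice in which $1$ is compact, the product of two compact elements is compact, and every element is a join of compact elements; $L^*$ denotes its compact elements. A proper element $p\ne1$ is prime if $xy\le p$ implies $x\le p$ or $y\le p$; maximal elements are maximal in $L\setminus\{1\}$; $L$ is a domain if $0$ is prime. An element $x$ is principal if $y\wedge zx=((y:x)\wedge z)x$ and $y\vee(z:x)=((yx\vee z):x)$ for all $y,z\in L$. $L$ is sharp if whenever $a_1a_2\le b$ with $a_1,a_2,b\in L$, there exist $b_1,b_2\in L$ with $a_i\le b_i$ ($i=1,2$) and $b=b_1b_2$. $L$ has finite character if every nonzero element is below only finitely many maximal elements. For $p$ prime and $x\in L$, $x_p=\bigvee\{a\in L^*: as\le x \text{ for some } s\in L^*,\ s\not\le p\}$, and $L_p=\{x_p:x\in L\}$ is a lattice with multiplication $(x,y)\mapsto(xy)_p$ and the induced order. $\mathbb{Z}_-$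 is the set of integers $\le0$ together with $-\infty$, with the usual order and addition as multiplication. $\mathbb{R}_1$ is the set of all intervals $(r,\infty]$ and $[r,\infty]$ with $r\ge0$ real, together with $\{\infty\}$, ordered by inclusion with interval addition as multiplication (isomorphic to the ideal lattice of a valuation domain with value group $\mathbb{R}$). *)

(* Defs.v *)
From Stdlib Require Import ZArith Reals List.
From Coquelicot Require Import Rbar.

Set Implicit Arguments.

Record MultLattice := MkMultLattice {
  mcar :> Type;
  mle : mcar -> mcar -> Prop;
  msup : (mcar -> Prop) -> mcar;
  mmul : mcar -> mcar -> mcar;
  mzero : mcar;
  mone : mcar;
  mle_refl : forall x, mle x x;
  mle_trans : forall x y z, mle x y -> mle y z -> mle x z;
  mle_antisym : forall x y, mle x y -> mle y x -> x = y;
  msup_ub : forall (S : mcar -> Prop) x, S x -> mle x (msup S);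
  msup_least : forall (S : mcar -> Prop) y,
      (forall x, S x -> mle x y) -> mle (msup S) y;
  mzero_bot : forall x, mle mzero x;
  mone_top : forall x, mle x mone;
  mmul_assoc : forall x y z, mmul x (mmul y z) = mmul (mmul x y) z;
  mmul_comm : forall x y, mmul x y = mmul y x;
  mmul_1l : forall x, mmul mone x = x;
  mmul_sup : forall a (S : mcar -> Prop),
      mmul a (msup S) = msup (fun y => exists b, S b /\ y = mmul a b)
}.

Arguments mle {m} _ _.
Arguments msup {m} _.
Arguments mmul {m} _ _.
Arguments mzero {m}.
Arguments mone {m}.

Section Notions.
Context {L : MultLattice}.

Definition mjoin (a b : L) : L := msup (fun t => t = a \/ t = b).
Definition mmeet (a b : L) : L := msup (fun t => mle t a /\ mle t b).

Definition mres (y x : L) : L := msup (fun a => mle (mmul a x) y).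

Definition compact (c : L) : Prop :=
  forall S : L -> Prop, mle c (msup S) ->
    exists T : list L, (forall t, In t T -> S t) /\ mle c (msup (fun t => In t T)).

Definition C_lattice : Prop :=
  compact mone /\
  (forall a b : L, compact a -> compact b -> compact (mmul a b)) /\
  (forall x : L, exists S : L -> Prop, (forall c, S c -> compact c) /\ x = msup S).

Definition prime (p : L) : Prop :=
  p <> mone /\ forall x y : L, mle (mmul x y) p -> mle x p \/ mle y p.

Definition maximal (m : L) : Prop :=
  m <> mone /\ forall x : L, mle m x -> x = m \/ x = mone.

Definition is_domain : Prop := prime mzero.

Definition principal (x : L) : Prop :=
  forall y z : L,
    mmeet y (mmul z x) = mmul (mmeet (mres y x) z) x /\
    mjoin y (mres z x) = mres (mjoin (mmul y x) z) x.

Definition sharp : Prop :=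
  forall a1 a2 b : L, mle (mmul a1 a2) b ->
    exists b1 b2 : L, mle a1 b1 /\ mle a2 b2 /\ b = mmul b1 b2.

Definition finite_character : Prop :=
  forall x : L, x <> mzero ->
    exists l : list L, forall m, maximal m -> mle x m -> In m l.

Definition loc (p x : L) : L :=
  msup (fun a => compact a /\
    exists s : L, compact s /\ ~ mle s p /\ mle (mmul a s) x).

Definition Lloc (p : L) : Type := { y : L | exists x : L, y = loc p x }.

Definition Lloc_le (p : L) (u v : Lloc p) : Prop := mle (proj1_sig u) (proj1_sig v).

Definition Lloc_mul (p : L) (u v : Lloc p) : Lloc p :=
  exist _ (loc p (mmul (proj1_sig u) (proj1_sig v)))
          (ex_intro _ (mmul (proj1_sig u) (proj1_sig v)) eq_refl).

End Notions.

Arguments C_lattice L : clear implicits.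
Arguments is_domain L : clear implicits.
Arguments sharp L : clear implicits.
Arguments finite_character L : clear implicits.

(** * Z_- : integers <= 0 together with -oo ([None]); order the usual one
    (with -oo least), multiplication = addition (-oo absorbing). *)
Definition in_Zminus (z : option Z) : Prop :=
  match z with None => True | Some n => (n <= 0)%Z end.

Definition Zminus_le (a b : option Z) : Prop :=
  match a, b with
  | None, _ => True
  | Some _, None => False
  | Some n, Some m => (n <= m)%Z
  end.

Definition Zminus_mul (a b : option Z) : option Z :=
  match a, b with
  | Some n, Some m => Some (n + m)%Z
  | _, _ => None
  end.

Definition iso_Zminus (L : MultLattice) (p : L) : Prop :=
  exists f : Lloc p -> option Z,
    (forall u v, f u = f v -> u = v) /\
    (forall u, in_Zminus (f u)) /\
    (forall z, in_Zminus z -> exists u, f u = z) /\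
    (forall u v, Lloc_le u v <-> Zminus_le (f u) (f v)) /\
    (forall u v, f (Lloc_mul u v) = Zminus_mul (f u) (f v)).

Definition set_eq (A B : Rbar -> Prop) : Prop := forall z, A z <-> B z.
Definition set_incl (A B : Rbar -> Prop) : Prop := forall z, A z -> B z.

Definition R1_open (r : R) : Rbar -> Prop := fun x => Rbar_lt (Finite r) x.
Definition R1_closed (r : R) : Rbar -> Prop := fun x => Rbar_le (Finite r) x.
Definition R1_inf : Rbar -> Prop := fun x => x = p_infty.

Definition in_R1 (A : Rbar -> Prop) : Prop :=
  (exists r : R, (0 <= r)%R /\ (set_eq A (R1_open r) \/ set_eq A (R1_closed r)))
  \/ set_eq A R1_inf.

Definition interval_add (A B : Rbar -> Prop) : Rbar -> Prop :=
  fun z => exists a b, A a /\ B b /\ z = Rbar_plus a b.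

Definition iso_R1 (L : MultLattice) (p : L) : Prop :=
  exists f : Lloc p -> (Rbar -> Prop),
    (forall u v, set_eq (f u) (f v) -> u = v) /\
    (forall u, in_R1 (f u)) /\
    (forall A, in_R1 A -> exists u, set_eq (f u) A) /\
    (forall u v, Lloc_le u v <-> set_incl (f u) (f v)) /\
    (forall u v, set_eq (f (Lloc_mul u v)) (interval_add (f u) (f v))).

Arguments iso_Zminus {L} p.
Arguments iso_R1 {L} p.

(* Main.v *)
(** (i) => (ii). Localizations of [L] are again sharp domains generated by principal elements,
    so let [L] be local with maximal element [m]. If [x] is nonzero principal, sharpness
    applied to [(x \/ y) ** (x : y) <= x] removes the common factor of [x] and [y]; for coprime
    [x, y <= m] it contradicts the factorization of [x ** x \/ y]. Hence [L] is a chain.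
    Sharpness applied to [a ** (p : a) <= p] gives every [a <> 0] a least principal upper bound,
    so the group of principal elements is archimedean and complete. If [m] is principal, the
    nonzero elements are its powers; otherwise comparing powers with those of a fixed element
    (Hoelder) gives a valuation of the principal elements onto the nonnegative reals.

    (ii) => (i). Both models are sharp, so [a1 ** a2 <= b] gives local factorizations [c, d] of
    [b] at the finitely many maximal elements [m] above [b]. The models are also archimedean:
    a compact element below [m] has a power below [c] and [d]. So [c] and [d] become [1] at the
    other maximal elements, and the meets of the [c]s and of the [d]s factor [b]. *)

From Stdlib Require Import ZArith Reals List Lia Lra.
From Stdlib Require Import Classical ClassicalChoice ClassicalEpsilon ProofIrrelevance.
From Coquelicot Require Import Rbar.
From mathcomp Require boolp classical_sets.
Require Import Defs.

Local Notation "x [<=] y" := (mle x y) (at level 70, no associativity).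
Local Notation "x ** y" := (mmul x y) (at level 40, left associativity).

(** * Multiplicative lattices and principal elements *)

Section Lattice.
Context {L : MultLattice}.
Implicit Types a b c t w x y z : L.

Lemma mmul_sup_least a (S : L -> Prop) z :
  (forall b, S b -> a ** b [<=] z) -> a ** msup S [<=] z.
Proof.
  intros H. rewrite mmul_sup. apply msup_least. intros w [b [Sb ->]]. auto.
Qed.

Lemma mmul_mono_r a b c : b [<=] c -> a ** b [<=] a ** c.
Proof.
  intros H.
  assert (E : c = msup (fun t => t = b \/ t = c)).
  { apply mle_antisym.
    - apply msup_ub; auto.
    - apply msup_least. intros x [-> | ->]; [exact H | apply mle_refl]. }
  rewrite E, mmul_sup. apply msup_ub. exists b; auto.
Qed.

Lemma mmul_mono x x' y y' : x [<=] x' -> y [<=] y' -> x ** y [<=] x' ** y'.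
Proof.
  intros H K. apply mle_trans with (x ** y'); [now apply mmul_mono_r |].
  rewrite (mmul_comm _ x), (mmul_comm _ x'). now apply mmul_mono_r.
Qed.

Lemma mmul_1r x : x ** mone = x.
Proof. rewrite mmul_comm. apply mmul_1l. Qed.

Lemma mmul_le_l x y : x ** y [<=] x.
Proof.
  rewrite <- (mmul_1r x) at 2. apply mmul_mono_r, mone_top.
Qed.

Lemma mmul_le_r x y : x ** y [<=] y.
Proof. rewrite mmul_comm. apply mmul_le_l. Qed.

Lemma mle_zero x : x [<=] mzero -> x = mzero.
Proof. intros H. apply mle_antisym; [exact H | apply mzero_bot]. Qed.

Lemma mle_one x : mone [<=] x -> x = mone.
Proof. intros H. apply mle_antisym; [apply mone_top | exact H]. Qed.

Lemma mmul_0r x : x ** mzero = mzero.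
Proof. apply mle_zero, mmul_le_r. Qed.

Lemma mmul_0l x : mzero ** x = mzero.
Proof. apply mle_zero, mmul_le_l. Qed.

Lemma mmul_swap a b c d : (a ** b) ** (c ** d) = (a ** c) ** (b ** d).
Proof.
  rewrite <- !mmul_assoc. f_equal. rewrite !mmul_assoc. f_equal. apply mmul_comm.
Qed.

Lemma mjoin_l x y : x [<=] mjoin x y.
Proof. apply msup_ub; auto. Qed.

Lemma mjoin_r x y : y [<=] mjoin x y.
Proof. apply msup_ub; auto. Qed.

Lemma mjoin_least x y z : x [<=] z -> y [<=] z -> mjoin x y [<=] z.
Proof. intros H K. apply msup_least. now intros t [-> | ->]. Qed.

Lemma mmul_join_least a x y z :
  a ** x [<=] z -> a ** y [<=] z -> a ** mjoin x y [<=] z.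
Proof. intros H K. apply mmul_sup_least. now intros t [-> | ->]. Qed.

Lemma mmeet_l x y : mmeet x y [<=] x.
Proof. apply msup_least. now intros t [H _]. Qed.

Lemma mmeet_r x y : mmeet x y [<=] y.
Proof. apply msup_least. now intros t [_ H]. Qed.

Lemma mmeet_greatest t x y : t [<=] x -> t [<=] y -> t [<=] mmeet x y.
Proof. intros H K. now apply msup_ub. Qed.

Lemma le_mres t x y : t ** x [<=] y -> t [<=] mres y x.
Proof. intros H. now apply msup_ub. Qed.

Lemma mres_mul x y : mres y x ** x [<=] y.
Proof.
  rewrite mmul_comm. apply mmul_sup_least. intros t H. now rewrite mmul_comm.
Qed.

Fixpoint mpow x (n : nat) : L :=
  match n with O => mone | S n => x ** mpow x n end.

Lemma mpow_1 x : mpow x 1 = x.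
Proof. apply mmul_1r. Qed.

Lemma mpow_add x n k : mpow x (n + k) = mpow x n ** mpow x k.
Proof.
  induction n as [|n IH]; simpl.
  - now rewrite mmul_1l.
  - now rewrite IH, mmul_assoc.
Qed.

Lemma mpow_mul x n k : mpow x (n * k) = mpow (mpow x n) k.
Proof.
  induction k as [|k IH].
  - now rewrite Nat.mul_0_r.
  - now rewrite Nat.mul_succ_r, Nat.add_comm, mpow_add, IH.
Qed.

Lemma mpow_mmul x y n : mpow (x ** y) n = mpow x n ** mpow y n.
Proof.
  induction n as [|n IH]; simpl.
  - now rewrite mmul_1l.
  - now rewrite IH, mmul_swap.
Qed.

Lemma mpow_mono x y n : x [<=] y -> mpow x n [<=] mpow y n.
Proof.
  intros H. induction n as [|n IH]; simpl; [apply mle_refl | now apply mmul_mono].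
Qed.

Lemma mpow_antitone x n k : (n <= k)%nat -> mpow x k [<=] mpow x n.
Proof.
  intros H. replace k with (n + (k - n))%nat by lia.
  rewrite mpow_add. apply mmul_le_l.
Qed.

(** An elementwise, residual-free form of [principal]: the first clause is join
    principality, the second one meet principality with [z = mone]. Unlike the
    definition, it passes to localizations without computing residuals there. *)
Definition cprincipal x : Prop :=
  (forall t y z, t ** x [<=] mjoin (y ** x) z ->
     exists w, w ** x [<=] z /\ t [<=] mjoin y w) /\
  (forall y, y [<=] x -> exists q, y = q ** x).

Lemma principal_cprincipal x : principal x -> cprincipal x.
Proof.
  intros P. split.
  - intros t y z H. exists (mres z x). split; [apply mres_mul |].
    destruct (P y z) as [_ ->]. now apply le_mres.
  - intros y H. destruct (P y mone) as [E _]. exists (mmeet (mres y x) mone).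
    rewrite <- E. rewrite mmul_1l. apply mle_antisym.
    + apply mmeet_greatest; [apply mle_refl | exact H].
    + apply mmeet_l.
Qed.

Definition nzp x : Prop := x <> mzero /\ cprincipal x.

End Lattice.

(** * Nonzero principal elements of a domain *)

Section Domain.
Context {L : MultLattice} (dom : is_domain L).
Implicit Types a b p q t w x y z : L.

Lemma mmul_eq0 x y : x ** y = mzero -> x = mzero \/ y = mzero.
Proof.
  intros H. destruct dom as [_ D].
  destruct (D x y) as [K | K]; [rewrite H; apply mle_refl | left | right];
    now apply mle_zero.
Qed.

Lemma mmul_neq0 x y : x <> mzero -> y <> mzero -> x ** y <> mzero.
Proof. intros H K E. destruct (mmul_eq0 _ _ E); auto. Qed.

Lemma mpow_neq0 x n : x <> mzero -> mpow x n <> mzero.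
Proof.
  intros H. induction n as [|n IH]; simpl.
  - intros E. apply dom. auto.
  - now apply mmul_neq0.
Qed.

(** Join principality with third element zero leaves only a remainder [w] with [w ** x = mzero], and
    a domain forces [w = mzero]. *)
Lemma nzp_cancel x t y : nzp x -> t ** x [<=] y ** x -> t [<=] y.
Proof.
  intros [N [P _]] H.
  destruct (P t y mzero) as [w [W1 W2]].
  { apply mle_trans with (1 := H), mjoin_l. }
  destruct (mmul_eq0 w x) as [-> | E]; [now apply mle_zero | | contradiction].
  apply mle_trans with (1 := W2). apply mjoin_least; [apply mle_refl | apply mzero_bot].
Qed.

Lemma nzp_cancel_eq x t y : nzp x -> t ** x = y ** x -> t = y.
Proof.
  intros P H. apply mle_antisym; apply (nzp_cancel x); auto; rewrite H; apply mle_refl.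
Qed.

Lemma nzp_one : nzp (mone : L).
Proof.
  split.
  - intros E. apply dom. auto.
  - split.
    + intros t y z. rewrite !mmul_1r. intros H. exists z. rewrite mmul_1r.
      split; [apply mle_refl | exact H].
    + intros y _. exists y. now rewrite mmul_1r.
Qed.

Lemma nzp_mul a b : nzp a -> nzp b -> nzp (a ** b).
Proof.
  intros Pa Pb. assert (C := fun t y => nzp_cancel b t y Pb).
  destruct Pa as [Na [A1 A2]], Pb as [Nb [B1 B2]]. split; [now apply mmul_neq0 |]. split.
  - intros t y z H. rewrite !mmul_assoc in H.
    destruct (B1 _ _ _ H) as [w [W1 W2]].
    destruct (A1 _ _ _ W2) as [w' [W3 W4]]. exists w'. split; [| exact W4].
    rewrite mmul_assoc. apply mle_trans with (2 := W1).
    apply mmul_mono; [exact W3 | apply mle_refl].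
  - intros y H. destruct (B2 y) as [q ->].
    { apply mle_trans with (1 := H). apply mmul_le_r. }
    destruct (A2 q (C _ _ H)) as [r ->]. exists r. now rewrite mmul_assoc.
Qed.

(** Each clause for [b] is multiplied by [a], read as a statement about [a ** b], and stripped of
    [a] again. Cancellation of [a] is inherited from that of [a ** b], so [a] itself need not yet be
    known to be principal. *)
Lemma nzp_factor_r a b : nzp (a ** b) -> nzp b.
Proof.
  intros P. assert (C := fun t y => nzp_cancel (a ** b) t y P).
  destruct P as [N [P1 P2]].
  assert (Ca : forall t y, t ** a [<=] y ** a -> t [<=] y).
  { intros t y H. apply C. rewrite !mmul_assoc. apply mmul_mono; [exact H | apply mle_refl]. }
  split; [intros ->; apply N, mmul_0r |]. split.
  - intros t y z H.
    destruct (P1 t y (z ** a)) as [w [W1 W2]].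
    { rewrite (mmul_comm _ a b), !mmul_assoc.
      rewrite (mmul_comm _ (t ** b)).
      apply mle_trans with (a ** mjoin (y ** b) z); [now apply mmul_mono_r |].
      apply mmul_join_least; rewrite mmul_comm; [apply mjoin_l | apply mjoin_r]. }
    exists w. split; [| exact W2]. apply Ca.
    now rewrite <- mmul_assoc, (mmul_comm _ b).
  - intros y H. destruct (P2 (a ** y)) as [q E]; [now apply mmul_mono_r |].
    exists q. apply mle_antisym; apply Ca;
      rewrite <- !mmul_assoc, (mmul_comm _ b), <- E, mmul_comm; apply mle_refl.
Qed.

Lemma nzp_factor_l a b : nzp (a ** b) -> nzp a.
Proof. rewrite mmul_comm. apply nzp_factor_r. Qed.

Lemma nzp_pow x n : nzp x -> nzp (mpow x n).
Proof.
  intros P. induction n as [|n IH]; simpl; [apply nzp_one | now apply nzp_mul].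
Qed.

Lemma nzp_divides x y : nzp x -> y [<=] x -> exists q, y = q ** x.
Proof. intros [_ [_ P]]. apply P. Qed.

End Domain.

(** * Local sharp domains *)

Section Local.
Context {L : MultLattice} (dom : is_domain L) (shp : sharp L).
Context (gen : forall x : L, exists S : L -> Prop,
            (forall a, S a -> cprincipal a) /\ x = msup S).
Context (m : L) (m_proper : m <> mone) (m_max : forall x : L, x <> mone -> x [<=] m)
        (m_neq0 : m <> mzero).
Implicit Types a b c p q t w x y z : L.

Lemma nzp_le x z : (forall p, nzp p -> p [<=] x -> p [<=] z) -> x [<=] z.
Proof.
  intros H. destruct (gen x) as [S [PS ->]]. apply msup_least. intros p Sp.
  destruct (classic (p = mzero)) as [-> | N]; [apply mzero_bot |].
  apply H; [split; auto | now apply msup_ub].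
Qed.

Lemma mmul_nzp_le a b z :
  (forall p q, nzp p -> nzp q -> p [<=] a -> q [<=] b -> p ** q [<=] z) -> a ** b [<=] z.
Proof.
  intros H. apply mle_trans with (mres z b ** b); [| apply mres_mul].
  apply mmul_mono; [| apply mle_refl]. apply nzp_le. intros p Pp pa.
  apply le_mres. rewrite mmul_comm.
  apply mle_trans with (mres z p ** p); [| apply mres_mul].
  apply mmul_mono; [| apply mle_refl]. apply nzp_le. intros q Pq qb.
  apply le_mres. rewrite mmul_comm. auto.
Qed.

Lemma nzp_below x : x <> mzero -> exists p, nzp p /\ p [<=] x.
Proof.
  intros N. apply NNPP. intros K. apply N, mle_zero, nzp_le.
  intros p P px. elim K. now exists p.
Qed.

Lemma nzp_separate x y : ~ x [<=] y -> exists p, nzp p /\ p [<=] x /\ ~ p [<=] y.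
Proof.
  intros N. apply NNPP. intros K. apply N, nzp_le.
  intros p P px. apply NNPP. intros py. elim K. now exists p.
Qed.

Lemma one_not_le_m : ~ mone [<=] m.
Proof. intros H. now apply m_proper, mle_one. Qed.

Lemma join_m_eq_one x y : mone [<=] mjoin x y -> x [<=] m -> y = mone.
Proof.
  intros H xm. apply NNPP. intros N. apply one_not_le_m, mle_trans with (1 := H).
  apply mjoin_least; auto.
Qed.

(** The witness [b = x ** x \/ y] contains [(x \/ y) ** (x \/ y)]; a factorization of it
    forces both factors to be [x \/ y], so that [y] lies in [x ** x \/ (x \/ y) ** y]. *)
Lemma not_coprime_below_m x y :
  nzp x -> nzp y -> x [<=] m -> y [<=] m ->
  (forall t, t ** x [<=] y -> t [<=] y) -> (forall t, t ** y [<=] x -> t [<=] x) -> False.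
Proof.
  intros Px Py xm ym Cxy Cyx.
  set (s := mjoin x y).
  destruct (shp s s (mjoin (x ** x) y)) as [b1 [b2 [s1 [s2 E]]]].
  { unfold s at 2. apply mmul_join_least; rewrite mmul_comm.
    - apply mmul_join_least; [apply mjoin_l |].
      apply mle_trans with y; [apply mmul_le_r | apply mjoin_r].
    - apply mle_trans with y; [apply mmul_le_l | apply mjoin_r]. }
  (* From [b ** x [<=] x ** x \/ y], join principality of [x] gives [b [<=] x \/ w] with [w ** x
     [<=] y], and [Cxy] puts [w] below [y]. *)
  assert (K : forall b b', mjoin (x ** x) y = b ** b' -> s [<=] b' -> b [<=] s).
  { intros b b' Eb sb.
    destruct Px as [Nx [Jx _]].
    destruct (Jx b x y) as [w [W1 W2]].
    { rewrite Eb. apply mmul_mono_r. apply mle_trans with (2 := sb), mjoin_l. }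
    apply mle_trans with (1 := W2). apply mjoin_least; [apply mjoin_l |].
    apply mle_trans with y; [auto | apply mjoin_r]. }
  assert (E1 : b1 [<=] s) by now apply (K b1 b2).
  assert (E2 : b2 [<=] s) by (apply (K b2 b1); [now rewrite (mmul_comm _ b2) | auto]).
  (* Here [y [<=] s ** y \/ x ** x], so join principality of [y] gives [mone [<=] s \/ w] with [w **
     y [<=] x ** x]. As [s [<=] m], [w] is [mone]; hence [y [<=] x], and [Cyx] yields [mone [<=]
     x]. *)
  destruct (proj1 (proj2 Py) mone s (x ** x)) as [w [W1 W2]].
  { rewrite mmul_1l. apply mle_trans with (mjoin (x ** x) y); [apply mjoin_r |].
    rewrite E. apply mle_trans with (s ** s); [now apply mmul_mono |].
    unfold s at 2. apply mmul_join_least.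
    - rewrite mmul_comm. apply mmul_join_least; [apply mjoin_r |].
      apply mle_trans with (s ** y); [| apply mjoin_l].
      apply mmul_mono; [apply mjoin_l | apply mle_refl].
    - apply mjoin_l. }
  assert (Ew : w = mone).
  { apply (join_m_eq_one s); [exact W2 | now apply mjoin_least]. }
  apply one_not_le_m. apply mle_trans with (2 := xm). apply Cyx.
  rewrite <- Ew. apply mle_trans with (1 := W1). apply mmul_le_l.
Qed.

(** The factor [d] divides both [x] and [y], with cofactors [x'] and [y'] that are coprime in the
    sense of [not_coprime_below_m]. One cofactor must therefore be [mone]. *)
Lemma nzp_total x y : nzp x -> nzp y -> x [<=] y \/ y [<=] x.
Proof.
  intros Px Py.
  destruct (shp (mjoin x y) (mres x y) x) as [d [x' [Hd [Hx' E]]]].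
  { rewrite mmul_comm. apply mmul_join_least; [apply mmul_le_r | apply mres_mul]. }
  assert (Pd : nzp d) by (apply (nzp_factor_l dom _ x'); congruence).
  assert (Px' : nzp x') by (apply (nzp_factor_r dom d); congruence).
  destruct (nzp_divides d y Pd) as [y' Ey].
  { apply mle_trans with (2 := Hd), mjoin_r. }
  assert (Py' : nzp y') by (apply (nzp_factor_l dom _ d); congruence).
  assert (Cyx : forall t, t ** y' [<=] x' -> t [<=] x').
  { intros t H. apply mle_trans with (2 := Hx'), le_mres.
    rewrite Ey, E, mmul_assoc, (mmul_comm _ d). now apply mmul_mono; [| apply mle_refl]. }
  (* With [t ** x' = q ** y'], [Cyx] makes [q] a multiple [r ** x']; cancelling [x'] leaves
     [t = r ** y']. *)
  assert (Cxy : forall t, t ** x' [<=] y' -> t [<=] y').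
  { intros t H. destruct (nzp_divides y' _ Py' H) as [q Eq].
    destruct (nzp_divides x' q Px') as [r ->].
    { apply Cyx. rewrite <- Eq. apply mmul_le_r. }
    rewrite <- mmul_assoc, (mmul_comm _ x' y'), mmul_assoc in Eq.
    rewrite (nzp_cancel_eq dom _ _ _ Px' Eq). apply mmul_le_r. }
  destruct (classic (x' = mone)) as [E1 | N1].
  - right. rewrite E, E1, mmul_1r. apply mle_trans with (2 := Hd), mjoin_r.
  - destruct (classic (y' = mone)) as [E2 | N2].
    + left. rewrite Ey, E2, mmul_1l. apply mle_trans with (2 := Hd), mjoin_l.
    + exfalso. apply (not_coprime_below_m x' y'); auto.
Qed.

Lemma le_total x y : x [<=] y \/ y [<=] x.
Proof.
  destruct (classic (x [<=] y)) as [H | H]; [now left | right].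
  destruct (nzp_separate _ _ H) as [p [Pp [px py]]].
  apply nzp_le. intros q Pq qy. apply mle_trans with (2 := px).
  destruct (nzp_total p q Pp Pq) as [K | K]; [| exact K].
  elim py. now apply mle_trans with q.
Qed.

(** Sharpness applied to [a ** (p : a) <= p], for a principal [p <= a]. *)
Lemma least_nzp_above a :
  a <> mzero ->
  exists d, nzp d /\ a [<=] d /\ forall c, nzp c -> a [<=] c -> d [<=] c.
Proof.
  intros N. destruct (nzp_below a N) as [p [Pp pa]].
  destruct (shp a (mres p a) p) as [d [e [Hd [He E]]]].
  { rewrite mmul_comm. apply mres_mul. }
  exists d. split; [apply (nzp_factor_l dom _ e); congruence |]. split; [exact Hd |].
  (* Writing [p = q ** c], the bound [q ** a [<=] p] gives [q [<=] (p : a) [<=] e]. Hence [d ** q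
     [<=] d ** e = p = c ** q], and [q] cancels. *)
  intros c Pc ac. destruct (nzp_divides c p Pc) as [q Eq]; [now apply mle_trans with a |].
  assert (Pq : nzp q) by (apply (nzp_factor_l dom _ c); congruence).
  apply (nzp_cancel dom q); [exact Pq |].
  rewrite (mmul_comm _ c), <- Eq, E. apply mmul_mono_r.
  apply mle_trans with (2 := He). apply le_mres. rewrite Eq. now apply mmul_mono_r.
Qed.

(** The intersection [c] of the powers of [x] satisfies [c = c ** x]; if it were nonzero, so
    would its least principal upper bound. *)
Lemma archimedean x y : nzp x -> x [<=] m -> y <> mzero -> exists n, ~ y [<=] mpow x n.
Proof.
  intros Px xm Ny. apply NNPP. intros K.
  assert (H : forall n, y [<=] mpow x n).
  { intros n. apply NNPP. intros K'. elim K. now exists n. }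
  set (c := msup (fun z => forall n, z [<=] mpow x n)).
  assert (yc : y [<=] c) by now apply msup_ub.
  assert (cx : forall n, c [<=] mpow x n) by (intros n; apply msup_least; auto).
  (* If [c = q ** x], cancelling [x] in [c [<=] mpow x (S n)] puts [q] below every power of [x],
     hence below [c]. *)
  assert (cxc : c [<=] c ** x).
  { destruct (nzp_divides x c Px) as [q E]; [rewrite <- (mpow_1 x); apply cx |].
    rewrite E at 1. apply mmul_mono; [| apply mle_refl]. apply msup_ub. intros n.
    apply (nzp_cancel dom x); [exact Px |]. rewrite <- E, mmul_comm. apply (cx (S n)). }
  destruct (least_nzp_above c) as [d [Pd [cd least]]].
  { intros E. apply Ny, mle_zero. now rewrite <- E. }
  apply one_not_le_m. apply mle_trans with (2 := xm).
  apply (nzp_cancel dom d); [exact Pd |]. rewrite mmul_1l.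
  apply least; [now apply nzp_mul |].
  apply mle_trans with (1 := cxc). rewrite mmul_comm. now apply mmul_mono_r.
Qed.

Lemma nat_last (P : nat -> Prop) n : P O -> ~ P n -> exists k, P k /\ ~ P (S k).
Proof.
  intros P0. induction n as [|n IH]; intros H; [contradiction |].
  destruct (classic (P n)) as [K | K]; [now exists n | auto].
Qed.

Lemma le_m_or_one x : x [<=] m \/ x = mone.
Proof. destruct (classic (x = mone)) as [H | H]; auto. Qed.

(** For the last power of [m] above [x], the cofactor of [x] cannot lie below [m], so it is
    [mone]. *)
Lemma discrete_mpow : cprincipal m ->
  forall x, x <> mzero -> exists k, x = mpow m k.
Proof.
  intros Cm x N. assert (Pm : nzp m) by now split.
  destruct (archimedean m x Pm (mle_refl _ _) N) as [n Hn].
  destruct (nat_last (fun k => x [<=] mpow m k) n) as [k [K1 K2]];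
    [apply mone_top | exact Hn |].
  exists k. destruct (nzp_divides _ _ (nzp_pow dom m k Pm) K1) as [q E].
  destruct (le_m_or_one q) as [qm | ->].
  - elim K2. rewrite E. simpl. apply mmul_mono; [exact qm | apply mle_refl].
  - now rewrite mmul_1l in E.
Qed.

Lemma mpow_le_iff u n k : nzp u -> u [<=] m -> (mpow u n [<=] mpow u k <-> (k <= n)%nat).
Proof.
  intros Pu um. split; [| apply mpow_antitone].
  intros H. destruct (le_lt_dec k n) as [K | K]; [exact K | exfalso].
  replace k with (S (k - n - 1) + n)%nat in H by lia. rewrite mpow_add in H.
  rewrite <- (mmul_1l _ (mpow u n)) in H at 1.
  apply (nzp_cancel dom _ _ _ (nzp_pow dom u n Pu)) in H.
  apply one_not_le_m. apply mle_trans with (1 := H).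
  apply mle_trans with (2 := um). apply mmul_le_l.
Qed.

Lemma local_Zminus : cprincipal m ->
  exists f : L -> option Z,
    (forall u v, f u = f v -> u = v) /\
    (forall u, in_Zminus (f u)) /\
    (forall z : option Z, in_Zminus z -> exists u, f u = z) /\
    (forall u v, u [<=] v <-> Zminus_le (f u) (f v)) /\
    (forall u v, f (u ** v) = Zminus_mul (f u) (f v)).
Proof.
  intros Cm. assert (Pm : nzp m) by now split.
  (* The inverse map is the explicit one: [-k] goes to the [k]-th power of [m] and minus infinity to
     zero. The isomorphism is then chosen from the surjectivity of [g]. *)
  set (g := fun z : option Z =>
    match z with Some n => mpow m (Z.to_nat (- n)) | None => mzero end).
  assert (g_le : forall a b : option Z, in_Zminus a -> in_Zminus b -> (g a [<=] g b <-> Zminus_le a b)).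
  { intros [a|] [b|]; simpl; intros Ha Hb.
    - rewrite mpow_le_iff by (auto using mle_refl). lia.
    - split; [| easy]. intros H. apply mle_zero in H. now apply (mpow_neq0 dom m) in H.
    - split; [easy | intros _; apply mzero_bot].
    - split; [easy | intros _; apply mle_refl]. }
  assert (g_onto : forall x, exists z : option Z, in_Zminus z /\ g z = x).
  { intros x. destruct (classic (x = mzero)) as [-> | N]; [now exists None |].
    destruct (discrete_mpow Cm x N) as [k ->]. exists (Some (- Z.of_nat k)%Z).
    simpl. split; [lia |]. f_equal. lia. }
  assert (g_inj : forall a b : option Z, in_Zminus a -> in_Zminus b -> g a = g b -> a = b).
  { intros a b Ha Hb E.
    assert (H : Zminus_le a b) by (apply g_le; auto; rewrite E; apply mle_refl).
    assert (K : Zminus_le b a) by (apply g_le; auto; rewrite E; apply mle_refl).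
    destruct a, b; simpl in *; try easy. f_equal. lia. }
  destruct (choice _ g_onto) as [f Hf].
  assert (f_in := fun x => proj1 (Hf x)). assert (gf := fun x => proj2 (Hf x)).
  exists f. split; [| split; [| split; [| split]]].
  - intros u v E. now rewrite <- (gf u), <- (gf v), E.
  - exact f_in.
  - intros z Hz. exists (g z). apply g_inj; auto.
  - intros u v. rewrite <- g_le by auto. now rewrite !gf.
  - intros u v. apply g_inj; auto.
    + generalize (f_in u), (f_in v). destruct (f u), (f v); simpl; lia.
    + rewrite gf. rewrite <- (gf u), <- (gf v) at 1. generalize (f_in u), (f_in v).
      destruct (f u) as [a|], (f v) as [b|]; simpl; intros Ha Hb;
        rewrite ?mmul_0l, ?mmul_0r; try reflexivity.
      rewrite <- mpow_add. f_equal. lia.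
Qed.

(** * The real valuation of a nondiscrete local sharp domain *)

Section Valuation.
Context (u : L) (Pu : nzp u) (um : u [<=] m).

(** [r] is the exponent of [x] relative to [u]: formally [x = u ^ r]. *)
Definition exponent x (r : R) : Prop :=
  forall n k : nat,
    (mpow x k [<=] mpow u n -> (INR n <= INR k * r)%R) /\
    (mpow u n [<=] mpow x k -> (INR k * r <= INR n)%R).

Lemma mpow_u_floor x : nzp x ->
  exists n, x [<=] mpow u n /\ mpow u (S n) [<=] x.
Proof.
  intros Px. destruct (archimedean u x Pu um (proj1 Px)) as [N HN].
  destruct (nat_last (fun k => x [<=] mpow u k) N) as [n [K1 K2]];
    [apply mone_top | exact HN |].
  exists n. split; [exact K1 |].
  destruct (le_total x (mpow u (S n))) as [H | H]; [contradiction | exact H].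
Qed.

(** A Dedekind cut: [E] consists of the fractions [n / k] with [mpow x k [<=] mpow u n], every
    fraction from a reverse comparison bounds it above, and its supremum is the exponent. *)
Lemma exponent_exists x : nzp x -> exists r, exponent x r.
Proof.
  intros Px.
  set (E := fun r => exists n k : nat,
    (0 < k)%nat /\ r = (INR n / INR k)%R /\ mpow x k [<=] mpow u n).
  (* Raising the comparisons to the powers [k'] and [k] brings both to the exponent [k * k'] of [x],
     where powers of [u] can be compared. *)
  assert (cmp : forall n k n' k', mpow x k [<=] mpow u n -> mpow u n' [<=] mpow x k' ->
            (n * k' <= n' * k)%nat).
  { intros n k n' k' H H'. apply (mpow_le_iff u); auto.
    rewrite !mpow_mul. apply mle_trans with (mpow (mpow x k') k); [now apply mpow_mono |].
    rewrite <- mpow_mul, Nat.mul_comm, mpow_mul. now apply mpow_mono. }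
  assert (ub : forall n' k', (0 < k')%nat -> mpow u n' [<=] mpow x k' ->
            is_upper_bound E (INR n' / INR k')%R).
  { intros n' k' k0' H' r [n [k [k0 [-> H]]]].
    assert (C := le_INR _ _ (cmp _ _ _ _ H H')). rewrite !mult_INR in C.
    apply lt_0_INR in k0, k0'.
    apply Rmult_le_reg_r with (INR k * INR k')%R; [nra |].
    now field_simplify; [lra | lra | lra]. }
  destruct (mpow_u_floor x Px) as [N [_ HN]].
  destruct (completeness E) as [r [r_ub r_least]].
  - exists (INR (S N) / INR 1)%R. apply ub; [lia | now rewrite (mpow_1 x)].
  - exists (INR 0 / INR 1)%R, 0%nat, 1%nat. split; [lia | split; [reflexivity |]].
    apply mone_top.
  (* For exponent zero no fraction is available; [mpow x 0 = mone] forces [n = 0] in the first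
     comparison. *)
  - exists r. intros n [|k].
    + split; intros H; simpl INR at 2.
      * apply (mpow_le_iff u 0) in H; auto. replace n with 0%nat by lia. simpl. lra.
      * rewrite Rmult_0_l. apply pos_INR.
    + assert (k0 : (0 < INR (S k))%R) by (apply lt_0_INR; lia).
      split; intros H.
      * apply Rmult_le_reg_r with (/ INR (S k))%R; [now apply Rinv_0_lt_compat |].
        replace (INR (S k) * r * / INR (S k))%R with r by (field; lra).
        apply r_ub. exists n, (S k). split; [lia | now split].
      * apply Rmult_le_reg_r with (/ INR (S k))%R; [now apply Rinv_0_lt_compat |].
        replace (INR (S k) * r * / INR (S k))%R with r by (field; lra).
        apply r_least, ub; [lia | exact H].
Qed.

(** The choice operator makes [val] total; its value is meaningful only on nonzero principal
    elements. *)
Definition val x : R := epsilon (inhabits 0%R) (exponent x).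

Lemma val_spec x : nzp x -> exponent x (val x).
Proof. intros Px. unfold val. apply epsilon_spec. now apply exponent_exists. Qed.

Lemma val_ge0 x : nzp x -> (0 <= val x)%R.
Proof.
  intros Px. destruct (val_spec x Px 0%nat 1%nat) as [H _]. simpl in H.
  rewrite Rmult_1_l in H. apply H, mone_top.
Qed.

(** The archimedean property with the roles exchanged: some power of [x] lies below [u], so a
    multiple of [val x] is at least one. *)
Lemma val_gt0 x : nzp x -> x [<=] m -> (0 < val x)%R.
Proof.
  intros Px xm. destruct (archimedean x u Px xm (proj1 Pu)) as [n Hn].
  destruct (le_total (mpow x n) (mpow u 1)) as [H | H];
    [| now rewrite mpow_1 in H].
  destruct (val_spec x Px 1%nat n) as [K _]. specialize (K H). simpl INR at 1 in K.
  assert (P := pos_INR n). assert (V := val_ge0 x Px). nra.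
Qed.

(** Both sides are within [2 / n] of each other, by comparing [n]-th powers. *)
Lemma val_mul x y : nzp x -> nzp y -> val (x ** y) = (val x + val y)%R.
Proof.
  intros Px Py. assert (Pxy := nzp_mul dom x y Px Py).
  assert (H : forall n, (INR n * Rabs (val (x ** y) - (val x + val y)) <= 2)%R).
  { intros n.
    (* With [i] and [j] the integer parts of the exponents of the [n]-th powers, both quantities
       times [n] lie between [i + j] and [i + j + 2]. *)
    destruct (mpow_u_floor (mpow x n) (nzp_pow dom x n Px)) as [i [X1 X2]].
    destruct (mpow_u_floor (mpow y n) (nzp_pow dom y n Py)) as [j [Y1 Y2]].
    destruct (val_spec x Px i n) as [A1 _]. destruct (val_spec x Px (S i) n) as [_ A2].
    destruct (val_spec y Py j n) as [B1 _]. destruct (val_spec y Py (S j) n) as [_ B2].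
    destruct (val_spec _ Pxy (i + j)%nat n) as [C1 _].
    destruct (val_spec _ Pxy (S i + S j)%nat n) as [_ C2].
    specialize (A1 X1). specialize (A2 X2). specialize (B1 Y1). specialize (B2 Y2).
    rewrite mpow_mmul, mpow_add in C1, C2.
    specialize (C1 (mmul_mono _ _ _ _ X1 Y1)). specialize (C2 (mmul_mono _ _ _ _ X2 Y2)).
    rewrite plus_INR in C1, C2. rewrite !S_INR in *.
    rewrite <- (Rabs_pos_eq (INR n)) by apply pos_INR. rewrite <- Rabs_mult.
    apply Rabs_le. lra. }
  apply NNPP. intros N.
  assert (P : (0 < Rabs (val (x ** y) - (val x + val y)))%R) by (apply Rabs_pos_lt; lra).
  destruct (INR_archimed _ 2 P) as [n Hn]. specialize (H n). lra.
Qed.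

Lemma val_one : val mone = 0%R.
Proof.
  assert (H := val_mul mone mone (nzp_one dom) (nzp_one dom)).
  rewrite mmul_1l in H. lra.
Qed.

(** For the converse, if [y = q ** x] then [val q] is not positive, so [q] is not below [m] and must
    be [mone]. *)
Lemma val_le x y : nzp x -> nzp y -> (x [<=] y <-> (val y <= val x)%R).
Proof.
  intros Px Py.
  assert (K : forall x y, nzp x -> nzp y -> x [<=] y ->
                exists q, nzp q /\ x = q ** y /\ val x = (val q + val y)%R).
  { clear x y Px Py. intros x y Px Py H. destruct (nzp_divides y x Py H) as [q E].
    assert (Pq : nzp q) by (apply (nzp_factor_l dom _ y); congruence).
    exists q. repeat split; try apply Pq; [exact E |]. rewrite E. now apply val_mul. }
  split; intros H.
  - destruct (K _ _ Px Py H) as [q [Pq [_ V]]]. assert (V' := val_ge0 q Pq). lra.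
  - destruct (le_total x y) as [C | C]; [exact C |].
    destruct (K _ _ Py Px C) as [q [Pq [E V]]].
    destruct (le_m_or_one q) as [qm | ->].
    + assert (V' := val_gt0 q Pq qm). lra.
    + rewrite mmul_1l in E. rewrite E. apply mle_refl.
Qed.

Lemma val_inj x y : nzp x -> nzp y -> val x = val y -> x = y.
Proof. intros Px Py E. apply mle_antisym; apply val_le; auto; lra. Qed.

Lemma val_pow x n : nzp x -> val (mpow x n) = (INR n * val x)%R.
Proof.
  intros Px. induction n as [|n IH].
  - simpl. rewrite val_one. lra.
  - rewrite S_INR. simpl mpow. rewrite val_mul, IH by auto using nzp_pow. lra.
Qed.

Context (m_not_principal : ~ cprincipal m).

(** Repeated halving from [u]: a principal [z [<=] m] is not [m], so some principal [z' [<=] m] lies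
    strictly above it. In [z = r ** z'] one of the two factors has at most half the value of [z]. *)
Lemma val_small e : (0 < e)%R -> exists x, nzp x /\ x [<=] m /\ (val x < e)%R.
Proof.
  intros He.
  assert (H : forall n, exists x, nzp x /\ x [<=] m /\ (2 ^ n * val x <= val u)%R).
  { induction n as [|n [z [Pz [zm V]]]].
    - exists u. repeat split; try apply Pu; [exact um | simpl; lra].
    - destruct (nzp_separate m z) as [z' [Pz' [zm' N]]].
      { intros K. apply m_not_principal.
        replace m with z by now apply mle_antisym. apply Pz. }
      destruct (nzp_divides z' z Pz') as [r E].
      { destruct (le_total z z') as [C | C]; [exact C | contradiction]. }
      assert (Pr : nzp r) by (apply (nzp_factor_l dom _ z'); congruence).
      assert (rm : r [<=] m).
      { destruct (le_m_or_one r) as [C | ->]; [exact C |].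
        elim N. rewrite E, mmul_1l. apply mle_refl. }
      assert (V' := val_mul r z' Pr Pz'). rewrite <- E in V'.
      assert (P : (0 < 2 ^ n)%R) by (apply pow_lt; lra).
      destruct (Rle_lt_dec (val r) (val z')).
      + exists r. repeat split; try apply Pr; [exact rm | simpl; nra].
      + exists z'. repeat split; try apply Pz'; [exact zm' | simpl; nra]. }
  destruct (Pow_x_infinity 2 ltac:(rewrite Rabs_pos_eq; lra) (val u / e + 1)) as [n Hn].
  destruct (H n) as [x [Px [xm V]]]. exists x. repeat split; try apply Px; [exact xm |].
  specialize (Hn n (Nat.le_refl _)). rewrite Rabs_pos_eq in Hn by (apply pow_le; lra).
  assert (K : (val u < 2 ^ n * e)%R).
  { apply Rmult_lt_reg_r with (/ e)%R; [now apply Rinv_0_lt_compat |].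
    replace (2 ^ n * e * / e)%R with (2 ^ n)%R by (field; lra). unfold Rdiv in Hn. lra. }
  assert (P : (0 < 2 ^ n)%R) by (apply pow_lt; lra). nra.
Qed.

Lemma val_between r s : (0 <= r < s)%R -> exists x, nzp x /\ (r <= val x < s)%R.
Proof.
  intros [r0 rs]. destruct (val_small (s - r)) as [z [Pz [zm V]]]; [lra |].
  assert (V0 := val_gt0 z Pz zm).
  destruct (INR_archimed (val z) r V0) as [N HN].
  (* The value zero is attained by [mone]; for [r > 0] the first multiple of [val z] reaching [r]
     overshoots by less than [s - r]. *)
  destruct (Req_dec r 0) as [-> | r1].
  { exists mone. split; [apply (nzp_one dom) |]. rewrite val_one. lra. }
  destruct (nat_last (fun k => INR k * val z < r)%R N) as [k [K1 K2]]; [simpl; lra | lra |].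
  exists (mpow z (S k)). split; [apply (nzp_pow dom z _ Pz) |].
  rewrite val_pow by exact Pz. rewrite S_INR in *. lra.
Qed.

(** The least principal [d] above all elements of value at least [r] has value [r]. If its value
    were smaller, [d ** z] with [val z] small would be a smaller bound; if larger, [val_between]
    gives an element of the join not below [d]. *)
Lemma val_onto r : (0 <= r)%R -> exists x, nzp x /\ val x = r.
Proof.
  intros r0. set (a := msup (fun x => nzp x /\ (r <= val x)%R)).
  destruct (val_between r (r + 1)) as [x [Px [Hx _]]]; [lra |].
  destruct (least_nzp_above a) as [d [Pd [ad least]]].
  { intros E. apply (proj1 Px), mle_zero. rewrite <- E. now apply msup_ub. }
  exists d. split; [exact Pd |].
  destruct (Rtotal_order (val d) r) as [H | [H | H]]; [exfalso | exact H | exfalso].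
  - destruct (val_small (r - val d)) as [z [Pz [zm V]]]; [lra |].
    assert (Pdz := nzp_mul dom d z Pd Pz).
    assert (K : d [<=] d ** z).
    { apply least; [exact Pdz |]. apply msup_least. intros y [Py Hy].
      apply val_le; auto. rewrite val_mul by auto. lra. }
    apply val_le in K; auto. rewrite val_mul in K by auto.
    assert (V0 := val_gt0 z Pz zm). lra.
  - destruct (val_between r (val d)) as [y [Py [Hy Hy']]]; [lra |].
    assert (K : y [<=] d) by (apply mle_trans with (2 := ad); now apply msup_ub).
    apply val_le in K; auto. lra.
Qed.

(** The value of zero is [p_infty], which therefore belongs to every interval. *)
Definition val_set a : Rbar -> Prop :=
  fun z : Rbar => z = p_infty \/ exists x, nzp x /\ x [<=] a /\ z = Finite (val x).

Lemma val_set_finite a x : nzp x -> (val_set a (Finite (val x)) <-> x [<=] a).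
Proof.
  intros Px. split.
  - intros [H | [y [Py [ya E]]]]; [discriminate |]. injection E as E.
    now rewrite (val_inj x y Px Py E).
  - intros H. right. now exists x.
Qed.

Lemma val_set_le a b : a [<=] b <-> set_incl (val_set a) (val_set b).
Proof.
  split.
  - intros H z [-> | [x [Px [xa ->]]]]; [now left | right].
    exists x. repeat split; try apply Px. now apply mle_trans with a.
  - intros H. apply nzp_le. intros p Pp pa.
    apply (val_set_finite b p Pp), H. now apply val_set_finite.
Qed.

(** By [val_onto] the nonnegative reals are exactly values, so there membership can be tested on
    principal elements. *)
Lemma set_eq_of_val (A B : Rbar -> Prop) :
  (A p_infty <-> B p_infty) -> (A m_infty <-> B m_infty) ->
  (forall r, (r < 0)%R -> (A (Finite r) <-> B (Finite r))) ->
  (forall x, nzp x -> (A (Finite (val x)) <-> B (Finite (val x)))) ->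
  set_eq A B.
Proof.
  intros Hp Hm Hn Hx [r | |]; [| exact Hp | exact Hm].
  destruct (Rlt_le_dec r 0) as [r0 | r0]; [now apply Hn |].
  destruct (val_onto r r0) as [x [Px <-]]. now apply Hx.
Qed.

Lemma val_set_m_infty a : ~ val_set a m_infty.
Proof. intros [H | [x [_ [_ H]]]]; discriminate. Qed.

Lemma val_set_neg a r : (r < 0)%R -> ~ val_set a (Finite r).
Proof.
  intros H [E | [x [Px [_ E]]]]; [discriminate |]. injection E as ->.
  assert (V := val_ge0 x Px). lra.
Qed.

Lemma val_set_zero : set_eq (val_set mzero) R1_inf.
Proof.
  intros z. split; [| intros ->; now left].
  intros [H | [x [Px [H _]]]]; [exact H |]. elim (proj1 Px). now apply mle_zero.
Qed.

Lemma val_set_closed d : nzp d -> set_eq (val_set d) (R1_closed (val d)).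
Proof.
  intros Pd. assert (V := val_ge0 d Pd). apply set_eq_of_val.
  - split; [easy | now left].
  - split; [intros H; now apply val_set_m_infty in H | easy].
  - intros r r0. split; [intros H; now apply val_set_neg in H |].
    unfold R1_closed; simpl; lra.
  - intros x Px. rewrite val_set_finite by exact Px. now apply val_le.
Qed.

Lemma val_set_open d a : nzp d ->
  (forall x, nzp x -> (x [<=] a <-> x [<=] d /\ x <> d)) ->
  set_eq (val_set a) (R1_open (val d)).
Proof.
  intros Pd Ha. assert (V := val_ge0 d Pd). apply set_eq_of_val.
  - split; [easy | now left].
  - split; [intros H; now apply val_set_m_infty in H | easy].
  - intros r r0. split; [intros H; now apply val_set_neg in H |].
    unfold R1_open; simpl; lra.
  - intros x Px. rewrite val_set_finite, Ha, val_le by auto.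
    unfold R1_open; simpl. split.
    + intros [H N]. assert (val d <> val x) by (intros E; now apply N, val_inj). lra.
    + intros H. split; [lra |]. intros ->. lra.
Qed.

Lemma val_set_in_R1 a : in_R1 (val_set a).
Proof.
  destruct (classic (a = mzero)) as [-> | N]; [right; apply val_set_zero | left].
  destruct (least_nzp_above a N) as [d [Pd [ad least]]].
  exists (val d). split; [now apply val_ge0 |].
  (* The endpoint is the value of the least principal [d] above [a]; the interval is closed exactly
     when [a] is [d] itself. *)
  destruct (classic (d [<=] a)) as [da | da].
  - right. replace a with d by now apply mle_antisym. now apply val_set_closed.
  - left. apply val_set_open; [exact Pd |]. intros x Px. split.
    + intros xa. split; [now apply mle_trans with a | now intros ->].
    + intros [xd nxd]. destruct (le_total x a) as [H | H]; [exact H |].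
      elim nxd. apply mle_antisym; auto.
Qed.

Lemma val_set_onto A : in_R1 A -> exists a, set_eq (val_set a) A.
Proof.
  assert (tr : forall A B C, set_eq A B -> set_eq C B -> set_eq A C).
  { intros X Y Z H K z. now rewrite (H z), (K z). }
  intros [[r [r0 H]] | H].
  - destruct (val_onto r r0) as [d [Pd <-]]. destruct H as [H | H].
    (* The principal elements strictly below [d] are the [q ** d] with [q [<=] m], so [d ** m]
       realizes the open interval. *)
    + exists (d ** m). apply tr with (2 := H). apply val_set_open; [exact Pd |].
      intros x Px. split.
      * intros xd. split; [apply mle_trans with (1 := xd), mmul_le_l |].
        intros ->. apply one_not_le_m, (nzp_cancel dom d); [exact Pd |].
        now rewrite mmul_1l, (mmul_comm _ m).
      * intros [xd nxd]. destruct (nzp_divides d x Pd xd) as [q ->].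
        rewrite mmul_comm. apply mmul_mono_r.
        destruct (le_m_or_one q) as [C | ->]; [exact C |]. elim nxd. apply mmul_1l.
    + exists d. apply tr with (2 := H). now apply val_set_closed.
  - exists mzero. apply tr with (2 := H). apply val_set_zero.
Qed.

Lemma val_set_mul a b : set_eq (val_set (a ** b)) (interval_add (val_set a) (val_set b)).
Proof.
  intros z. split.
  - intros [-> | [x [Px [xab ->]]]].
    { exists p_infty, p_infty. repeat split; now left. }
    (* If [x] were below no single product [p ** q], each such product would be a multiple [r ** x]
       with [r [<=] m]. Then [x [<=] a ** b [<=] m ** x], and cancelling [x] gives [mone [<=] m]. *)
    assert (H : exists p q, nzp p /\ nzp q /\ p [<=] a /\ q [<=] b /\ x [<=] p ** q).
    { apply NNPP. intros N. apply one_not_le_m, (nzp_cancel dom x); [exact Px |].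
      rewrite mmul_1l. apply mle_trans with (1 := xab). apply mmul_nzp_le.
      intros p q Pp Pq pa qb.
      assert (C : ~ x [<=] p ** q) by (intros C; apply N; now exists p, q).
      destruct (nzp_divides x (p ** q) Px) as [r E].
      { destruct (le_total x (p ** q)) as [D | D]; [contradiction | exact D]. }
      rewrite E. apply mmul_mono; [| apply mle_refl].
      destruct (le_m_or_one r) as [D | ->]; [exact D |].
      elim C. rewrite E, mmul_1l. apply mle_refl. }
    destruct H as [p [q [Pp [Pq [pa [qb xpq]]]]]].
    destruct (nzp_divides (p ** q) x (nzp_mul dom _ _ Pp Pq) xpq) as [r E].
    rewrite (mmul_comm _ p q), mmul_assoc in E.
    assert (Prq : nzp (r ** q)) by (apply (nzp_factor_l dom _ p); congruence).
    exists (Finite (val p)), (Finite (val (r ** q))).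
    rewrite !val_set_finite by auto. split; [exact pa |]. split.
    + apply mle_trans with (2 := qb), mmul_le_r.
    + rewrite E, val_mul by auto. simpl. f_equal. lra.
  - intros [x [y [Hx [Hy ->]]]].
    destruct Hx as [-> | [p [Pp [pa ->]]]], Hy as [-> | [q [Pq [qb ->]]]]; simpl;
      try now left.
    right. exists (p ** q). split; [now apply nzp_mul |]. split; [now apply mmul_mono |].
    now rewrite val_mul.
Qed.

End Valuation.

Lemma local_R1 : ~ cprincipal m ->
  exists f : L -> (Rbar -> Prop),
    (forall u v, set_eq (f u) (f v) -> u = v) /\
    (forall u, in_R1 (f u)) /\
    (forall A, in_R1 A -> exists u, set_eq (f u) A) /\
    (forall u v, u [<=] v <-> set_incl (f u) (f v)) /\
    (forall u v, set_eq (f (u ** v)) (interval_add (f u) (f v))).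
Proof.
  intros Nm. destruct (nzp_below m m_neq0) as [u [Pu um]].
  exists (val_set u). split; [| split; [| split; [| split]]].
  - intros a b E. apply mle_antisym; apply (val_set_le u Pu um); intros z; apply E.
  - intros a. now apply val_set_in_R1.
  - intros A. now apply val_set_onto.
  - intros a b. now apply val_set_le.
  - intros a b. now apply val_set_mul.
Qed.

End Local.

(** * Localization *)

Section Localization.
Context {L : MultLattice} (CL : C_lattice L) (m : L) (pm : prime m).
Implicit Types a b c s t x y z : L.

Lemma compact_one : compact (mone : L).
Proof. apply CL. Qed.

Lemma compact_mul a b : compact a -> compact b -> compact (a ** b).
Proof. apply CL. Qed.

Lemma compact_pow a n : compact a -> compact (mpow a n).
Proof.
  intros H. induction n as [|n IH]; simpl; [apply compact_one | now apply compact_mul].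
Qed.

Lemma compact_le x z : (forall c, compact c -> c [<=] x -> c [<=] z) -> x [<=] z.
Proof.
  intros H. destruct CL as [_ [_ G]]. destruct (G x) as [S [CS ->]].
  apply msup_least. intros c Sc. apply H; [auto | now apply msup_ub].
Qed.

Lemma compact_separate x y : ~ x [<=] y -> exists c, compact c /\ c [<=] x /\ ~ c [<=] y.
Proof.
  intros N. apply NNPP. intros K. apply N, compact_le.
  intros c Cc cx. apply NNPP. intros cy. elim K. now exists c.
Qed.

Lemma prime_mul s t : ~ s [<=] m -> ~ t [<=] m -> ~ s ** t [<=] m.
Proof. intros Hs Ht H. destruct (proj2 pm _ _ H); contradiction. Qed.

Lemma prime_pow s n : ~ s [<=] m -> ~ mpow s n [<=] m.
Proof.
  intros Hs. induction n as [|n IH]; simpl; [| now apply prime_mul].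
  intros H. now apply pm, mle_one.
Qed.

Lemma loc_intro c s x : compact c -> compact s -> ~ s [<=] m -> c ** s [<=] x -> c [<=] loc m x.
Proof. intros Cc Cs Ns H. apply msup_ub. split; [exact Cc |]. now exists s. Qed.

(** Compactness leaves finitely many generators of [loc m x]; the product of their denominators
    serves all of them and avoids [m] by primality. *)
Lemma loc_elim c x : compact c -> c [<=] loc m x ->
  exists s, compact s /\ ~ s [<=] m /\ c ** s [<=] x.
Proof.
  intros Cc H. destruct (Cc _ H) as [T [HT cT]].
  assert (K : exists s, compact s /\ ~ s [<=] m /\ forall t, In t T -> s ** t [<=] x).
  { clear cT. induction T as [|a T IH].
    - exists mone. split; [apply compact_one |]. split; [| easy].
      intros E. now apply pm, mle_one.
    - destruct IH as [s [Cs [Ns Hs]]]; [intros t Ht; apply HT; now right |].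
      destruct (HT a) as [_ [r [Cr [Nr Hr]]]]; [now left |].
      exists (r ** s). split; [now apply compact_mul |]. split; [now apply prime_mul |].
      intros t [<- | Ht].
      + rewrite <- mmul_assoc, (mmul_comm _ s), mmul_assoc, (mmul_comm _ r).
        apply mle_trans with (1 := mmul_le_l _ _). exact Hr.
      + rewrite <- mmul_assoc. apply mle_trans with (1 := mmul_le_r _ _). auto. }
  destruct K as [s [Cs [Ns Hs]]]. exists s. split; [exact Cs |]. split; [exact Ns |].
  rewrite mmul_comm. apply mle_trans with (1 := mmul_mono_r s _ _ cT).
  now apply mmul_sup_least.
Qed.

Lemma loc_incr x : x [<=] loc m x.
Proof.
  apply compact_le. intros c Cc cx. apply (loc_intro c mone); auto using compact_one.
  - intros E. now apply pm, mle_one.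
  - now rewrite mmul_1r.
Qed.

Lemma loc_least x y : x [<=] loc m y -> loc m x [<=] loc m y.
Proof.
  intros H. apply compact_le. intros c Cc Hc.
  destruct (loc_elim c x Cc Hc) as [s [Cs [Ns Hs]]].
  destruct (loc_elim (c ** s) y) as [r [Cr [Nr Hr]]];
    [now apply compact_mul | now apply mle_trans with x |].
  apply (loc_intro c (s ** r)); auto using compact_mul, prime_mul.
  now rewrite mmul_assoc.
Qed.

Lemma loc_mono x y : x [<=] y -> loc m x [<=] loc m y.
Proof. intros H. apply loc_least, mle_trans with (1 := H), loc_incr. Qed.

Lemma loc_idem x : loc m (loc m x) = loc m x.
Proof. apply mle_antisym; [apply loc_least, mle_refl | apply loc_incr]. Qed.

Lemma mul_loc_r a x z : a ** x [<=] loc m z -> a ** loc m x [<=] loc m z.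
Proof.
  intros H. apply mle_trans with (msup (fun c => compact c /\ c [<=] a) ** loc m x).
  { apply mmul_mono; [| apply mle_refl]. apply compact_le. intros c Cc ca. now apply msup_ub. }
  rewrite mmul_comm. apply mmul_sup_least. intros c [Cc ca]. rewrite mmul_comm.
  apply mmul_sup_least. intros d [Cd [s [Cs [Ns Hs]]]].
  rewrite <- (loc_idem z). apply (loc_intro _ s); auto using compact_mul.
  rewrite <- mmul_assoc. apply mle_trans with (2 := H). now apply mmul_mono.
Qed.

Lemma loc_mul_r x y : loc m (x ** loc m y) = loc m (x ** y).
Proof.
  apply mle_antisym.
  - apply loc_least, mul_loc_r, loc_incr.
  - apply loc_mono, mmul_mono_r, loc_incr.
Qed.

Lemma loc_mul_l x y : loc m (loc m x ** y) = loc m (x ** y).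
Proof. now rewrite mmul_comm, loc_mul_r, mmul_comm. Qed.

Lemma loc_of_prime : loc m m = m.
Proof.
  apply mle_antisym; [| apply loc_incr]. apply msup_least.
  intros c [_ [s [_ [Ns H]]]]. destruct (proj2 pm _ _ H); [assumption | contradiction].
Qed.

Lemma loc_eq_one x : ~ x [<=] m -> loc m x = mone.
Proof.
  intros N. destruct (compact_separate _ _ N) as [s [Cs [sx Ns]]].
  apply mle_one. apply (loc_intro _ s); auto using compact_one. now rewrite mmul_1l.
Qed.

Lemma loc_zero : is_domain L -> loc m mzero = mzero.
Proof.
  intros dom. apply mle_zero, msup_least. intros c [_ [s [_ [Ns H]]]].
  destruct (mmul_eq0 dom c s) as [-> | ->]; [now apply mle_zero | apply mle_refl |].
  elim Ns. apply mzero_bot.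
Qed.

Definition to_loc x : Lloc m := exist _ (loc m x) (ex_intro _ x eq_refl).

Lemma Lloc_eq (u v : Lloc m) : proj1_sig u = proj1_sig v -> u = v.
Proof.
  destruct u as [x Hx], v as [y Hy]. simpl. intros ->. f_equal. apply proof_irrelevance.
Qed.

Lemma loc_proj (u : Lloc m) : loc m (proj1_sig u) = proj1_sig u.
Proof. destruct u as [x [y ->]]. apply loc_idem. Qed.

Definition Lloc_sup (S : Lloc m -> Prop) : Lloc m :=
  to_loc (msup (fun x => exists u, S u /\ x = proj1_sig u)).

Lemma Lloc_sup_ub (S : Lloc m -> Prop) u : S u -> Lloc_le u (Lloc_sup S).
Proof.
  intros H. apply mle_trans with (2 := loc_incr _). apply msup_ub. now exists u.
Qed.

Lemma Lloc_sup_least (S : Lloc m -> Prop) v :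
  (forall u, S u -> Lloc_le u v) -> Lloc_le (Lloc_sup S) v.
Proof.
  intros H. unfold Lloc_le. rewrite <- (loc_proj v). apply loc_mono, msup_least.
  intros x [u [Su ->]]. now apply H.
Qed.

(** The definition is transparent so that order and product compute to [Lloc_le] and [Lloc_mul];
    results on local lattices then match [iso_Zminus] and [iso_R1] by conversion. *)
Definition Lloc_lattice : MultLattice.
Proof.
  refine (@MkMultLattice (Lloc m) (@Lloc_le L m) Lloc_sup (@Lloc_mul L m)
            (to_loc mzero) (to_loc mone) _ _ _ Lloc_sup_ub Lloc_sup_least _ _ _ _ _ _).
  - intros x. apply mle_refl.
  - intros x y z. apply mle_trans.
  - intros x y H K. now apply Lloc_eq, mle_antisym.
  - intros u. unfold Lloc_le. rewrite <- (loc_proj u). apply loc_mono, mzero_bot.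
  - intros u. apply mle_trans with (1 := mone_top _ _), loc_incr.
  - intros x y z. apply Lloc_eq. simpl. now rewrite loc_mul_l, loc_mul_r, mmul_assoc.
  - intros x y. apply Lloc_eq. simpl. now rewrite mmul_comm.
  - intros x. apply Lloc_eq. simpl. now rewrite loc_mul_l, mmul_1l, loc_proj.
  - intros a S. apply Lloc_eq. apply mle_antisym.
    + simpl. apply loc_least, mul_loc_r, mmul_sup_least. intros b [u [Su ->]].
      apply mle_trans with (1 := loc_incr _), loc_mono.
      apply mle_trans with (1 := loc_incr _), msup_ub.
      exists (Lloc_mul a u). split; [now exists u | reflexivity].
    + apply (Lloc_sup_least _ (Lloc_mul a (Lloc_sup S))). intros w [u [Su ->]].
      apply loc_mono, mmul_mono_r, (Lloc_sup_ub S u Su).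
Defined.

End Localization.

(** * Principal elements and sharpness under localization *)

Section PrincipalLocalization.
Context {L : MultLattice} (CL : C_lattice L) (dom : is_domain L).
Implicit Types a b c s t x y z : L.

(** Let [E] collect the [w] for which [w ** x] is below a finite subjoin. Each compact element below
    [x] is [q ** x] with [q] in [E], so cancelling [x] gives [mone [<=] msup E], and compactness of
    [mone] selects finitely many [w]. *)
Lemma nzp_compact x : nzp x -> compact x.
Proof.
  intros Px S xS.
  set (E := fun w => exists T, (forall t, In t T -> S t) /\ w ** x [<=] msup (fun t => In t T)).
  destruct (compact_one CL E) as [W [WE HW]].
  { apply (nzp_cancel dom x); [exact Px |]. rewrite mmul_1l.
    apply (compact_le CL). intros c Cc cx.
    destruct (Cc S) as [T [TS cT]]; [now apply mle_trans with x |].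
    destruct (nzp_divides x c Px cx) as [q ->].
    apply mmul_mono; [| apply mle_refl]. apply msup_ub. now exists T. }
  assert (K : exists T, (forall t, In t T -> S t) /\
            forall w, In w W -> w ** x [<=] msup (fun t => In t T)).
  { clear HW. induction W as [|w W IH]; [now exists nil |].
    destruct IH as [T [TS HT]]; [intros; apply WE; now right |].
    destruct (WE w) as [T' [TS' HT']]; [now left |].
    exists (T' ++ T). split.
    - intros t Ht. apply in_app_or in Ht. destruct Ht; auto.
    - intros w' [<- | Hw]; [apply mle_trans with (1 := HT') | apply mle_trans with (1 := HT _ Hw)];
        apply msup_least; intros t Ht; apply msup_ub, in_or_app; auto. }
  destruct K as [T [TS HT]]. exists T. split; [exact TS |].
  rewrite <- (mmul_1l _ x). apply mle_trans with (msup (fun t => In t W) ** x).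
  - apply mmul_mono; [exact HW | apply mle_refl].
  - rewrite mmul_comm. apply mmul_sup_least. intros w Hw. rewrite mmul_comm. auto.
Qed.

Context (m : L) (pm : prime m).

Lemma Lloc_mjoin (u v : Lloc_lattice CL m pm) :
  proj1_sig (mjoin u v) = loc m (mjoin (proj1_sig u) (proj1_sig v)).
Proof.
  simpl. f_equal. unfold mjoin. apply mle_antisym; apply msup_least; intros x Hx.
  - destruct Hx as [w [[-> | ->] ->]]; apply msup_ub; auto.
  - apply msup_ub. destruct Hx as [-> | ->]; eauto.
Qed.

(** Both clauses are tested on compact elements: a denominator [s] outside [m] is cleared, the
    clause for [x] in [L] applies, and the witness is the localized residual by [x]. *)
Lemma to_loc_cprincipal x : nzp x -> @cprincipal (Lloc_lattice CL m pm) (to_loc m x).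
Proof.
  intros Px. assert (Cx := nzp_compact x Px).
  assert (E : forall a, loc m (a ** loc m x) = loc m (a ** x))
    by (intros a; apply (loc_mul_r CL m pm)).
  destruct Px as [_ [P1 P2]]. split.
  - intros t y z H. set (r := mres (proj1_sig z) x).
    exists (to_loc m r). split.
    + simpl. unfold Lloc_le. simpl. rewrite E, (loc_mul_l CL m pm), <- (loc_proj CL m pm z).
      apply (loc_mono CL m pm), mres_mul.
    + assert (K : proj1_sig (t ** to_loc m x) [<=]
                  proj1_sig (@mjoin (Lloc_lattice CL m pm) (y ** to_loc m x) z)) by exact H.
      rewrite Lloc_mjoin in K. simpl in K. rewrite !E in K.
      change (proj1_sig t [<=] proj1_sig (@mjoin (Lloc_lattice CL m pm) y (to_loc m r))).
      rewrite Lloc_mjoin.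
      apply (compact_le CL). intros c Cc ct.
      destruct (loc_elim CL m pm (c ** x) (mjoin (proj1_sig y ** x) (proj1_sig z)))
        as [s [Cs [Ns Hs]]]; [now apply (compact_mul CL) | |].
      { apply mle_trans with (proj1_sig t ** x);
          [apply mmul_mono; [exact ct | apply mle_refl] |].
        apply mle_trans with (1 := loc_incr CL m pm _), mle_trans with (1 := K).
        apply (loc_least CL m pm), mjoin_least.
        - apply (loc_mono CL m pm), mjoin_l.
        - apply mle_trans with (2 := loc_incr CL m pm _), mjoin_r. }
      rewrite <- mmul_assoc, (mmul_comm _ x), mmul_assoc in Hs.
      destruct (P1 _ _ _ Hs) as [w [W1 W2]].
      apply (loc_intro m c s); auto. apply mle_trans with (1 := W2).
      apply mjoin_least; [apply mjoin_l |]. apply mle_trans with (2 := mjoin_r _ _).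
      apply mle_trans with (2 := loc_incr CL m pm _). now apply le_mres.
  - intros y H. set (r := mres (proj1_sig y) x). exists (to_loc m r).
    apply Lloc_eq. simpl. rewrite E, (loc_mul_l CL m pm). apply mle_antisym.
    + apply (compact_le CL). intros c Cc cy.
      destruct (loc_elim CL m pm c x) as [s [Cs [Ns Hs]]];
        [exact Cc | now apply mle_trans with (proj1_sig y) |].
      apply (loc_intro m c s); auto. destruct (P2 _ Hs) as [q Eq].
      rewrite Eq. apply mmul_mono; [| apply mle_refl]. apply le_mres. rewrite <- Eq.
      apply mle_trans with (2 := cy), mmul_le_l.
    + rewrite <- (loc_proj CL m pm y). apply (loc_mono CL m pm), mres_mul.
Qed.

Context (gen : forall x : L, exists S : L -> Prop,
            (forall a, S a -> cprincipal a) /\ x = msup S).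

Lemma Lloc_generated (u : Lloc_lattice CL m pm) :
  exists S : Lloc_lattice CL m pm -> Prop, (forall v, S v -> cprincipal v) /\ u = msup S.
Proof.
  destruct (gen (proj1_sig u)) as [S [PS E]].
  (* Zero generators are dropped: they add nothing to the join, and [to_loc_cprincipal] concerns
     nonzero elements. *)
  exists (fun v => exists a, S a /\ a <> mzero /\ v = to_loc m a). split.
  - intros v [a [Sa [Na ->]]]. apply to_loc_cprincipal. split; auto.
  - apply (mle_antisym (Lloc_lattice CL m pm)).
    + apply mle_trans with (2 := loc_incr CL m pm _). rewrite E. apply msup_least. intros a Sa.
      destruct (classic (a = mzero)) as [-> | Na]; [apply mzero_bot |].
      apply mle_trans with (1 := loc_incr CL m pm a), msup_ub.
      exists (to_loc m a). split; [now exists a | reflexivity].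
    + apply (msup_least (Lloc_lattice CL m pm)). intros v [a [Sa [_ ->]]].
      simpl. unfold Lloc_le. rewrite <- (loc_proj CL m pm u).
      apply (loc_mono CL m pm). rewrite E. now apply msup_ub.
Qed.

Lemma Lloc_domain : is_domain (Lloc_lattice CL m pm).
Proof.
  assert (Z := loc_zero m dom). split.
  - intros E. apply (f_equal (@proj1_sig _ _)) in E. simpl in E. rewrite Z in E.
    apply (proj1 pm), mle_one. apply mle_trans with (1 := loc_incr CL m pm _).
    rewrite <- E. apply mzero_bot.
  - intros x y H. simpl in *. unfold Lloc_le in *. simpl in *. rewrite Z in *.
    apply (proj2 dom). apply mle_trans with (2 := H), (loc_incr CL m pm).
Qed.

Lemma Lloc_sharp : sharp L -> sharp (Lloc_lattice CL m pm).
Proof.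
  intros shp a1 a2 b H.
  destruct (shp (proj1_sig a1) (proj1_sig a2) (proj1_sig b)) as [b1 [b2 [H1 [H2 E]]]].
  { apply mle_trans with (2 := H), (loc_incr CL m pm). }
  exists (to_loc m b1), (to_loc m b2).
  split; [apply mle_trans with (1 := H1), (loc_incr CL m pm) |].
  split; [apply mle_trans with (1 := H2), (loc_incr CL m pm) |].
  apply Lloc_eq. simpl.
  now rewrite (loc_mul_l CL m pm), (loc_mul_r CL m pm), <- E, (loc_proj CL m pm).
Qed.

Lemma Lloc_le_max (u : Lloc_lattice CL m pm) : u <> mone -> mle u (to_loc m m).
Proof.
  intros N. simpl. unfold Lloc_le. simpl. rewrite (loc_of_prime CL m pm).
  apply NNPP. intros K. apply N, Lloc_eq.
  rewrite <- (loc_proj CL m pm u). rewrite (loc_eq_one CL m _ K).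
  symmetry. apply mle_one, (loc_incr CL m pm).
Qed.

Lemma Lloc_max_neq_one : to_loc m m <> (mone : Lloc_lattice CL m pm).
Proof.
  intros E. apply (f_equal (@proj1_sig _ _)) in E. simpl in E.
  rewrite (loc_of_prime CL m pm) in E. apply (proj1 pm), mle_one. rewrite E.
  apply (loc_incr CL m pm).
Qed.

Lemma Lloc_max_neq_zero : m <> mzero -> to_loc m m <> (mzero : Lloc_lattice CL m pm).
Proof.
  intros N E. apply (f_equal (@proj1_sig _ _)) in E. simpl in E.
  rewrite (loc_of_prime CL m pm), (loc_zero m dom) in E. contradiction.
Qed.

Lemma sharp_localization : sharp L -> m <> mzero -> iso_Zminus m \/ iso_R1 m.
Proof.
  intros shp N.
  assert (G := Lloc_generated). assert (D := Lloc_domain). assert (S := Lloc_sharp shp).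
  assert (M1 := Lloc_max_neq_one). assert (M2 := Lloc_le_max).
  assert (M3 := Lloc_max_neq_zero N).
  destruct (classic (@cprincipal (Lloc_lattice CL m pm) (to_loc m m))) as [P | P].
  - left. exact (local_Zminus D S G _ M1 M2 M3 P).
  - right. exact (local_R1 D S G _ M1 M2 M3 P).
Qed.

End PrincipalLocalization.

(** * Maximal elements and chains *)

Lemma maximal_prime {L : MultLattice} (m : L) : maximal m -> prime m.
Proof.
  intros [N M]. split; [exact N |]. intros x y H.
  assert (K : forall z, ~ z [<=] m -> mjoin m z = mone).
  { intros z Nz. destruct (M _ (mjoin_l m z)) as [E | E]; [| exact E].
    elim Nz. rewrite <- E. apply mjoin_r. }
  apply NNPP. intros C. apply N, mle_one.
  rewrite <- (mmul_1l _ mone).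
  rewrite <- (K x) at 1 by tauto. rewrite <- (K y) by tauto.
  apply mmul_join_least; [apply mmul_le_r |]. rewrite mmul_comm.
  apply mmul_join_least; [apply mmul_le_r | now rewrite mmul_comm].
Qed.

(** With compactness, this places a compact element below a join of a chain under a single member.
    Nonemptiness of [S] covers the empty list. *)
Lemma chain_finite_sup {L : MultLattice} (S : L -> Prop) (T : list L) :
  (exists s, S s) -> (forall s t, S s -> S t -> s [<=] t \/ t [<=] s) ->
  (forall t, In t T -> S t) -> exists s, S s /\ msup (fun t => In t T) [<=] s.
Proof.
  intros [s0 S0] tot. induction T as [|a T IH]; intros HT.
  - exists s0. split; [exact S0 | now apply msup_least].
  - destruct IH as [s [Ss Hs]]; [intros; apply HT; now right |].
    assert (K : forall t, In t T -> t [<=] s)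
      by (intros t Ht; apply mle_trans with (2 := Hs); now apply msup_ub).
    destruct (tot s a Ss) as [H | H]; [apply HT; now left | |].
    + exists a. split; [apply HT; now left |]. apply msup_least.
      intros t [<- | Ht]; [apply mle_refl | apply mle_trans with s; auto].
    + exists s. split; [exact Ss |]. apply msup_least. intros t [<- | Ht]; auto.
Qed.

(** Zorn's lemma on the proper elements above [x]: the join of a chain stays proper because [mone]
    is compact. *)
Lemma maximal_above {L : MultLattice} (x : L) :
  compact (mone : L) -> x <> mone -> exists m : L, maximal m /\ x [<=] m.
Proof.
  intros C1 N.
  set (T := {y : L | x [<=] y /\ y <> mone}).
  set (R := fun s t : T => boolp.asbool (proj1_sig s [<=] proj1_sig t)).
  assert (RE : forall s t, is_true (R s t) <-> proj1_sig s [<=] proj1_sig t).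
  { intros s t. symmetry. exact (ssrbool.rwP (boolp.asboolP _)). }
  destruct (@classical_sets.Zorn T R) as [[m [xm Nm]] Hm].
  - intros t. apply RE, mle_refl.
  - intros r s t. rewrite !RE. apply mle_trans.
  - intros [s Hs] [t Ht]. rewrite !RE. simpl. intros H K.
    assert (E := mle_antisym _ _ _ H K). subst t. f_equal. apply proof_irrelevance.
  - intros A totA.
    (* Adjoining [x] gives the empty chain an upper bound above [x] too. *)
    set (S := fun y => y = x \/ exists s, A s /\ y = proj1_sig s).
    assert (xS : x [<=] msup S) by (apply msup_ub; now left).
    assert (NS : msup S <> mone).
    { intros E. destruct (C1 S) as [l [lS Hl]]; [rewrite E; apply mle_refl |].
      destruct (chain_finite_sup S l) as [y [Sy Hy]]; [exists x; now left | | exact lS |].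
      - intros y z [-> | [[y' Hy'] [Ay ->]]] [-> | [[z' Hz'] [Az ->]]]; simpl.
        + left. apply mle_refl.
        + left. apply Hz'.
        + right. apply Hy'.
        + destruct (totA _ _ Ay Az) as [H | H]; apply RE in H; auto.
      - assert (E1 : y = mone) by now apply mle_one, mle_trans with (1 := Hl).
        destruct Sy as [Ey | [[y' [Hy' Ny]] [_ Ey]]]; simpl in Ey; congruence. }
    exists (exist _ (msup S) (conj xS NS)). intros s As. apply RE. simpl.
    apply msup_ub. right. now exists s.
  - exists m. split; [| exact xm]. split; [exact Nm |]. intros y my.
    destruct (classic (y = mone)) as [E | Ny]; [now right | left].
    assert (xy : x [<=] y) by now apply mle_trans with m.
    assert (E := Hm (exist _ y (conj xy Ny)) ltac:(now apply RE)).
    now apply (f_equal (@proj1_sig _ _)) in E.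
Qed.

(** * Sharpness of the two models *)

(** The two inclusions allow open and closed intervals with endpoint [r] to be treated together. *)
Lemma in_R1_cases A : in_R1 A ->
  set_eq A R1_inf \/
  exists r, (0 <= r)%R /\ set_incl (R1_open r) A /\ set_incl A (R1_closed r) /\
    (set_eq A (R1_open r) \/ set_eq A (R1_closed r)).
Proof.
  intros [[r [r0 H]] | H]; [right | now left]. exists r. split; [exact r0 |].
  assert (K : set_incl (R1_open r) (R1_closed r)).
  { intros [z | |]; unfold R1_open, R1_closed; simpl; lra. }
  split; [| split]; [| | exact H]; destruct H as [H | H]; intros z Hz; apply H in Hz || apply H;
    auto.
Qed.

Lemma in_R1_nonneg A : in_R1 A -> set_incl A (R1_closed 0).
Proof.
  intros HA z Az. destruct (in_R1_cases A HA) as [H | [r [r0 [_ [H _]]]]].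
  - apply H in Az. now rewrite Az.
  - apply H in Az. destruct z; unfold R1_closed in *; simpl in *; lra.
Qed.

Lemma in_R1_p_infty A : in_R1 A -> A p_infty.
Proof.
  intros HA. destruct (in_R1_cases A HA) as [H | [r [_ [H _]]]]; now apply H.
Qed.

Lemma closed_in_R1 r : (0 <= r)%R -> in_R1 (R1_closed r).
Proof. intros H. left. exists r. split; [exact H |]. now right. Qed.

Lemma open_in_R1 r : (0 <= r)%R -> in_R1 (R1_open r).
Proof. intros H. left. exists r. split; [exact H |]. now left. Qed.

Lemma interval_add_comm A B : set_eq (interval_add A B) (interval_add B A).
Proof.
  intros z. split; intros [x [y [Hx [Hy ->]]]]; exists y, x; repeat split; auto;
    apply Rbar_plus_comm.
Qed.

Lemma interval_add_closed r s :
  set_eq (interval_add (R1_closed r) (R1_closed s)) (R1_closed (r + s)).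
Proof.
  intros z. split.
  - intros [[x | |] [[y | |] [Hx [Hy ->]]]]; unfold R1_closed in *; simpl in *; easy || lra.
  - destruct z as [z | |]; intros Hz; [| now exists p_infty, p_infty | easy].
    exists (Finite r), (Finite (z - r)). unfold R1_closed in *; simpl in *.
    repeat split; try lra. f_equal. lra.
Qed.

Lemma interval_add_closed_open r s :
  set_eq (interval_add (R1_closed r) (R1_open s)) (R1_open (r + s)).
Proof.
  intros z. split.
  - intros [[x | |] [[y | |] [Hx [Hy ->]]]]; unfold R1_closed, R1_open in *; simpl in *;
      easy || lra.
  - destruct z as [z | |]; intros Hz; [| now exists p_infty, p_infty | easy].
    exists (Finite r), (Finite (z - r)). unfold R1_closed, R1_open in *; simpl in *.
    repeat split; try lra. f_equal. lra.
Qed.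

Lemma interval_add_unit A : in_R1 A -> set_eq (interval_add A (R1_closed 0)) A.
Proof.
  intros HA z. split.
  - intros [x [y [Ax [Hy ->]]]].
    destruct x as [x | |]; [| | now apply (in_R1_nonneg A HA) in Ax].
    + destruct y as [y | |]; [| now apply (in_R1_p_infty A HA) | easy].
      unfold R1_closed in Hy. simpl in *.
      destruct (in_R1_cases A HA) as [H | [r [_ [_ [_ [H | H]]]]]]; apply H in Ax; apply H;
        unfold R1_inf, R1_open, R1_closed in *; simpl in *; easy || lra.
    + destruct y; easy.
  - intros Az. exists z, (Finite 0). split; [exact Az |]. split; [apply Rle_refl |].
    now rewrite Rbar_plus_0_r.
Qed.

(** For finite endpoints [a1], [a2], [b] the hypothesis amounts to [b <= a1 + a2] up to the openness
    of the ends. The endpoint [b] is split as [min(a1, b)] plus the rest, and openness of [B] is put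
    into one factor. *)
Lemma R1_sharp A1 A2 B : in_R1 A1 -> in_R1 A2 -> in_R1 B ->
  set_incl (interval_add A1 A2) B ->
  exists B1 B2, in_R1 B1 /\ in_R1 B2 /\ set_incl A1 B1 /\ set_incl A2 B2 /\
    set_eq B (interval_add B1 B2).
Proof.
  intros H1 H2 HB Hinc.
  assert (left_unit : set_incl A1 B -> exists B1 B2, in_R1 B1 /\ in_R1 B2 /\
            set_incl A1 B1 /\ set_incl A2 B2 /\ set_eq B (interval_add B1 B2)).
  { intros K. exists B, (R1_closed 0). split; [exact HB |].
    split; [apply closed_in_R1, Rle_refl |]. split; [exact K |].
    split; [now apply in_R1_nonneg |]. intros z. now rewrite (interval_add_unit B HB z). }
  destruct (in_R1_cases A1 H1) as [E1 | [a1 [a1_0 [O1 [C1 _]]]]].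
  { apply left_unit. intros z Hz. apply E1 in Hz. rewrite Hz. now apply in_R1_p_infty. }
  destruct (in_R1_cases A2 H2) as [E2 | [a2 [a2_0 [O2 [C2 _]]]]].
  { exists (R1_closed 0), B. split; [apply closed_in_R1, Rle_refl |]. split; [exact HB |].
    split; [now apply in_R1_nonneg |]. split.
    - intros z Hz. apply E2 in Hz. rewrite Hz. now apply in_R1_p_infty.
    - intros z. now rewrite (interval_add_comm _ _ z), (interval_add_unit B HB z). }
  assert (sums : forall e, (0 < e)%R -> B (Finite (a1 + a2 + e))).
  { intros e He. apply Hinc. exists (Finite (a1 + e / 2)), (Finite (a2 + e / 2)).
    split; [apply O1; unfold R1_open; simpl; lra |].
    split; [apply O2; unfold R1_open; simpl; lra |]. simpl. f_equal. lra. }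
  destruct (in_R1_cases B HB) as [EB | [b [b0 [OB [CB EB]]]]].
  { specialize (sums 1%R Rlt_0_1). now apply EB in sums. }
  assert (le : (b <= a1 + a2)%R).
  { apply Rnot_lt_le. intros K. specialize (sums ((b - (a1 + a2)) / 2)%R).
    specialize (CB _ (sums ltac:(lra))). unfold R1_closed in CB. simpl in CB. lra. }
  assert (mn := Rmin_l a1 b). assert (mn' := Rmin_r a1 b).
  assert (mn0 : (0 <= Rmin a1 b)%R) by now apply Rmin_glb.
  destruct EB as [EB | EB].
  - destruct (Rlt_le_dec b a1) as [K | K]; [| destruct le as [lt | E]].
    + apply left_unit. intros z Hz. apply EB. apply C1 in Hz.
      destruct z; unfold R1_closed, R1_open in *; simpl in *; easy || lra.
    + exists (R1_closed a1), (R1_open (b - a1)).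
      split; [now apply closed_in_R1 |]. split; [apply open_in_R1; lra |].
      split; [exact C1 |]. split.
      * intros z Hz. apply C2 in Hz.
        destruct z; unfold R1_closed, R1_open in *; simpl in *; easy || lra.
      * intros z. rewrite (EB z), (interval_add_closed_open _ _ z).
        now replace (a1 + (b - a1))%R with b by lra.
    (* When [b = a1 + a2], an open second factor would start at [a2] and could miss [a2] itself.
       Instead [A1] and [A2] already add up to [B], the excess over [b] being halved between
       them. *)
    + exists A1, A2. split; [exact H1 |]. split; [exact H2 |].
      split; [now intros z |]. split; [now intros z |].
      intros z. split; [| apply Hinc]. intros Hz. apply EB in Hz.
      destruct z as [z | |]; [| | easy].
      * unfold R1_open in Hz. simpl in Hz.
        exists (Finite (a1 + (z - b) / 2)), (Finite (a2 + (z - b) / 2)).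
        split; [apply O1; unfold R1_open; simpl; lra |].
        split; [apply O2; unfold R1_open; simpl; lra |]. simpl. f_equal. lra.
      * exists p_infty, p_infty. split; [now apply in_R1_p_infty |].
        split; [now apply in_R1_p_infty | reflexivity].
  - exists (R1_closed (Rmin a1 b)), (R1_closed (b - Rmin a1 b)).
    split; [now apply closed_in_R1 |]. split; [apply closed_in_R1; lra |]. split; [| split].
    + intros z Hz. apply C1 in Hz.
      destruct z; unfold R1_closed in *; simpl in *; easy || lra.
    + intros z Hz. apply C2 in Hz. unfold Rmin in *.
      destruct (Rle_dec a1 b), z; unfold R1_closed in *; simpl in *; easy || lra.
    + intros z. rewrite (EB z), (interval_add_closed _ _ z).
      now replace (Rmin a1 b + (b - Rmin a1 b))%R with b by lra.
Qed.

Lemma Zminus_sharp (a1 a2 b : option Z) :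
  in_Zminus a1 -> in_Zminus a2 -> in_Zminus b -> Zminus_le (Zminus_mul a1 a2) b ->
  exists b1 b2, in_Zminus b1 /\ in_Zminus b2 /\ Zminus_le a1 b1 /\ Zminus_le a2 b2 /\
    b = Zminus_mul b1 b2.
Proof.
  intros H1 H2 HB H.
  destruct a1 as [n1|]; [destruct a2 as [n2|]; [destruct b as [k|] |] |].
  (* The first factor is the join of [n1] and [k]; since it is at least [k], the remaining
     difference is nonpositive. *)
  - exists (Some (Z.max n1 k)), (Some (k - Z.max n1 k)%Z). simpl in *.
    repeat split; try lia. f_equal. lia.
  - contradiction.
  - exists (Some 0%Z), b. destruct b; simpl; repeat split; auto; lia.
  - exists b, (Some 0%Z). destruct b, a2; simpl in *; repeat split; auto; try lia; f_equal; lia.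
Qed.

(** * From the localizations back to the lattice *)

Section Converse.
Context {L : MultLattice} (CL : C_lattice L) (dom : is_domain L).
Implicit Types a b c s t x y z : L.

Section OneMaximal.
Context (m : L) (pm : prime m).

Lemma iso_Zminus_sharp : iso_Zminus m -> sharp (Lloc_lattice CL m pm).
Proof.
  intros [f [f_inj [f_in [f_onto [f_le f_mul]]]]] a1 a2 b H.
  assert (K := proj1 (f_le (Lloc_mul a1 a2) b) H). rewrite f_mul in K.
  destruct (Zminus_sharp _ _ _ (f_in _) (f_in _) (f_in _) K)
    as [z1 [z2 [Z1 [Z2 [le1 [le2 E]]]]]].
  destruct (f_onto z1 Z1) as [b1 <-], (f_onto z2 Z2) as [b2 <-].
  exists b1, b2. split; [now apply f_le |]. split; [now apply f_le |].
  apply f_inj. exact (eq_trans E (eq_sym (f_mul b1 b2))).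
Qed.

Lemma iso_R1_sharp : iso_R1 m -> sharp (Lloc_lattice CL m pm).
Proof.
  intros [f [f_inj [f_in [f_onto [f_le f_mul]]]]] a1 a2 b H.
  assert (K := proj1 (f_le (Lloc_mul a1 a2) b) H).
  destruct (R1_sharp _ _ _ (f_in a1) (f_in a2) (f_in b)) as [B1 [B2 [H1 [H2 [le1 [le2 E]]]]]].
  { intros z Hz. apply K. now apply f_mul. }
  destruct (f_onto B1 H1) as [b1 E1], (f_onto B2 H2) as [b2 E2].
  exists b1, b2. split; [apply f_le; intros z Hz; now apply E1, le1 |].
  split; [apply f_le; intros z Hz; now apply E2, le2 |].
  apply f_inj. intros z. apply iff_trans with (2 := iff_sym (f_mul b1 b2 z)). rewrite (E z).
  split; intros [x [y [Hx [Hy ->]]]]; exists x, y; repeat split; auto;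
    now apply E1 || apply E2.
Qed.

Lemma mpow_le_Lloc t (u : Lloc_lattice CL m pm) n :
  t [<=] proj1_sig u -> mpow t n [<=] proj1_sig (mpow u n).
Proof.
  intros H. induction n as [|n IH]; simpl; [apply (loc_incr CL m pm) |].
  apply mle_trans with (2 := loc_incr CL m pm _). now apply mmul_mono.
Qed.

Lemma loc_not_le_zero b : b <> mzero -> ~ loc m b [<=] loc m mzero.
Proof.
  intros N H. apply N, mle_zero. rewrite <- (loc_zero m dom).
  apply mle_trans with (2 := H), (loc_incr CL m pm).
Qed.

(** Value zero would put [mone] below [m], so [t] has value at most [-1] and its [n]-th power value
    at most [-n]. *)
Lemma iso_Zminus_archimedean t b :
  iso_Zminus m -> t [<=] m -> b <> mzero -> exists n, mpow t n [<=] loc m b.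
Proof.
  intros [f [f_inj [f_in [f_onto [f_le f_mul]]]]] tm Nb.
  assert (Ft : Zminus_le (f (to_loc m t)) (Some (-1)%Z)).
  { assert (K := f_in (to_loc m t)).
    destruct (f (to_loc m t)) as [k|] eqn:E; [| easy]. simpl in *.
    destruct (Z.eq_dec k 0) as [-> | Nk]; [| lia]. exfalso.
    apply (proj1 pm), mle_one. rewrite <- (loc_of_prime CL m pm).
    apply mle_trans with (2 := loc_mono CL m pm _ _ tm).
    apply mle_trans with (1 := loc_incr CL m pm _).
    apply (f_le (to_loc m mone) (to_loc m t)). rewrite E.
    assert (K' := f_in (to_loc m mone)). destruct (f (to_loc m mone)); simpl in *; auto. }
  destruct (f (to_loc m b)) as [j|] eqn:Eb.
  - exists (Z.to_nat (- j)). set (n := Z.to_nat (- j)).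
    apply mle_trans with (1 := mpow_le_Lloc t (to_loc m t) n (loc_incr CL m pm t)).
    apply (f_le _ (to_loc m b)). rewrite Eb.
    assert (K : forall n, Zminus_le (f (@mpow (Lloc_lattice CL m pm) (to_loc m t) n))
                            (Some (- Z.of_nat n)%Z)).
    { clear n. induction n as [|n IH].
      - apply f_in.
      - simpl. rewrite f_mul.
        destruct (f (to_loc m t)); [| easy].
        destruct (f (@mpow (Lloc_lattice CL m pm) (to_loc m t) n)); [| easy].
        simpl in *. lia. }
    specialize (K n). assert (Kb := f_in (to_loc m b)). rewrite Eb in Kb. simpl in Kb.
    destruct (f (@mpow (Lloc_lattice CL m pm) (to_loc m t) n)); [| easy].
    simpl in *. unfold n in K. lia.
  - exfalso. apply (loc_not_le_zero b Nb).
    apply (f_le (to_loc m b) (to_loc m mzero)). now rewrite Eb.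
Qed.

(** Compactness of [t] puts it below some [[r, oo]] with [r > 0]; without it [t] might be the
    idempotent [(0, oo]]. *)
Lemma iso_R1_archimedean t b :
  iso_R1 m -> compact t -> t [<=] m -> b <> mzero -> exists n, mpow t n [<=] loc m b.
Proof.
  intros [f [f_inj [f_in [f_onto [f_le f_mul]]]]] Ct tm Nb.
  set (Y := fun y => exists (u : Lloc m) (r : R),
              y = proj1_sig u /\ (0 < r)%R /\ set_eq (f u) (R1_closed r)).
  assert (Yr : forall r : R, (0 < r)%R -> exists u, Y (proj1_sig u) /\ set_eq (f u) (R1_closed r)).
  { intros r r0. destruct (f_onto (R1_closed r)) as [u Hu]; [apply closed_in_R1; lra |].
    exists u. split; [now exists u, r | exact Hu]. }
  (* All values in the interval of [m] are positive: if zero occurred, the interval would contain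
     every nonnegative value and [mone] would be below [m]. *)
  assert (mY : m [<=] loc m (msup Y)).
  { rewrite <- (loc_of_prime CL m pm) at 1.
    apply (f_le (to_loc m m) (to_loc m (msup Y))).
    assert (K : forall r : R, (0 < r)%R -> set_incl (R1_closed r) (f (to_loc m (msup Y)))).
    { intros r r0 z Hz. destruct (Yr r r0) as [u [Yu Hu]]. apply Hu in Hz.
      revert z Hz. apply f_le. apply mle_trans with (2 := loc_incr CL m pm _).
      now apply msup_ub. }
    intros [z | |] Hz; [| now apply (K 1%R Rlt_0_1) | now apply in_R1_nonneg in Hz].
    destruct (Rle_lt_dec z 0) as [z0 | z0].
    - exfalso. apply (proj1 pm), mle_one. rewrite <- (loc_of_prime CL m pm).
      apply mle_trans with (1 := loc_incr CL m pm _).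
      apply (f_le (to_loc m mone) (to_loc m m)).
      assert (C : set_incl (R1_closed 0) (f (to_loc m m))).
      { intros y Hy. apply (interval_add_unit _ (f_in _)). exists (Finite z), y.
        assert (z1 := in_R1_nonneg _ (f_in _) _ Hz). unfold R1_closed in z1. simpl in z1.
        replace z with 0%R in * by lra. split; [exact Hz |]. split; [exact Hy |].
        now rewrite Rbar_plus_0_l. }
      intros y Hy. apply C. now apply in_R1_nonneg in Hy.
    - apply (K z z0). apply Rle_refl. }
  destruct (loc_elim CL m pm t (msup Y) Ct) as [s [Cs [Ns Hs]]]; [now apply mle_trans with m |].
  (* [Y] is a chain, so the compact [t ** s] lies below a single member [u]; as [u] is localized,
     [t] does too. *)
  destruct (compact_mul CL _ _ Ct Cs Y Hs) as [T [TY HT]].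
  destruct (chain_finite_sup Y T) as [y [[u [r [-> [r0 Hu]]]] Hy]]; [| | exact TY |].
  - destruct (Yr 1%R Rlt_0_1) as [u [Yu _]]. eauto.
  - intros x y [u [r [-> [r0 Hu]]]] [v [q [-> [q0 Hv]]]].
    destruct (Rle_lt_dec r q) as [K | K]; [right | left];
      apply f_le; intros z Hz; apply Hu + apply Hv; apply Hu in Hz || apply Hv in Hz;
      destruct z; unfold R1_closed in *; simpl in *; easy || lra.
  - assert (tu : t [<=] proj1_sig u).
    { rewrite <- (loc_proj CL m pm u). apply (loc_intro m t s); auto.
      apply mle_trans with (1 := HT), Hy. }
    destruct (in_R1_cases _ (f_in (to_loc m b))) as [E | [r1 [r1_0 [O _]]]].
    { exfalso. apply (loc_not_le_zero b Nb). apply (f_le (to_loc m b) (to_loc m mzero)).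
      intros z Hz. apply E in Hz. rewrite Hz. now apply in_R1_p_infty. }
    destruct (INR_archimed r r1 r0) as [n Hn]. exists n.
    apply mle_trans with (1 := mpow_le_Lloc t u n tu).
    apply (f_le _ (to_loc m b)).
    assert (K : forall n, set_incl (f (@mpow (Lloc_lattice CL m pm) u n)) (R1_closed (INR n * r))).
    { clear n Hn. induction n as [|n IH].
      - simpl INR. rewrite Rmult_0_l. apply in_R1_nonneg, f_in.
      - intros z Hz. apply f_mul in Hz. destruct Hz as [x [y [Hx [Hy' ->]]]].
        replace (INR (S n) * r)%R with (r + INR n * r)%R by (rewrite S_INR; lra).
        apply interval_add_closed. exists x, y. split; [now apply Hu |]. split; [now apply IH |].
        reflexivity. }
    intros z Hz. apply O. apply K in Hz.
    destruct z; unfold R1_closed, R1_open in *; simpl in *; easy || lra.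
Qed.

End OneMaximal.

(** If a compact [c [<=] x] is not below [y], the residual [(y : c)] is proper and lies below some
    maximal [m]. The denominator witnessing [c [<=] loc m y] is below that residual, hence below
    [m]. *)
Lemma le_of_loc x y : (forall m, maximal m -> x [<=] loc m y) -> x [<=] y.
Proof.
  intros H. apply (compact_le CL). intros c Cc cx.
  destruct (classic (mres y c = mone)) as [E | N].
  - rewrite <- (mmul_1l _ c), <- E. apply mres_mul.
  - destruct (maximal_above _ (compact_one CL) N) as [m [Mm Hm]].
    destruct (loc_elim CL m (maximal_prime m Mm) c y Cc) as [s [Cs [Ns Hs]]];
      [now apply mle_trans with x, H |].
    elim Ns. apply mle_trans with (2 := Hm), le_mres. now rewrite mmul_comm.
Qed.

Context (iso : forall m : L, maximal m -> iso_Zminus m \/ iso_R1 m).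

(** The last clause makes the factors trivial at every other maximal [m']: a compact [t] below [m]
    but not below [m'] has a power below [loc m b], hence below both factors. *)
Lemma local_factorization a1 a2 b m :
  a1 ** a2 [<=] b -> b <> mzero -> maximal m ->
  exists c d, a1 [<=] c /\ a2 [<=] d /\ c ** d [<=] loc m b /\ b [<=] loc m (c ** d) /\
    forall m', maximal m' -> m' <> m ->
      exists s, compact s /\ ~ s [<=] m' /\ s [<=] c /\ s [<=] d.
Proof.
  intros H Nb Mm. assert (pm := maximal_prime m Mm).
  assert (Sh : sharp (Lloc_lattice CL m pm)).
  { destruct (iso m Mm); [now apply iso_Zminus_sharp | now apply iso_R1_sharp]. }
  destruct (Sh (to_loc m a1) (to_loc m a2) (to_loc m b)) as [u [v [H1 [H2 E]]]].
  { simpl. unfold Lloc_le. simpl. rewrite (loc_mul_l CL m pm), (loc_mul_r CL m pm).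
    now apply (loc_mono CL m pm). }
  apply (f_equal (@proj1_sig _ _)) in E. simpl in E.
  exists (proj1_sig u), (proj1_sig v).
  split; [apply mle_trans with (2 := H1), (loc_incr CL m pm) |].
  split; [apply mle_trans with (2 := H2), (loc_incr CL m pm) |].
  split; [rewrite E; apply (loc_incr CL m pm) |].
  split; [rewrite <- E; apply (loc_incr CL m pm) |].
  intros m' Mm' Nm. assert (pm' := maximal_prime m' Mm').
  assert (Nle : ~ m [<=] m').
  { intros K. destruct (proj2 Mm _ K) as [C | C]; [contradiction | now apply (proj1 Mm')]. }
  destruct (compact_separate CL _ _ Nle) as [t [Ct [tm tm']]].
  assert (A : exists n, mpow t n [<=] loc m b).
  { destruct (iso m Mm); [now apply (iso_Zminus_archimedean m pm) |
                          now apply (iso_R1_archimedean m pm)]. }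
  destruct A as [n Hn]. exists (mpow t n).
  split; [now apply (compact_pow CL) |]. split; [now apply prime_pow |].
  rewrite E in Hn. split; apply mle_trans with (1 := Hn).
  - rewrite <- (loc_proj CL m pm u) at 2. apply (loc_mono CL m pm), mmul_le_l.
  - rewrite <- (loc_proj CL m pm v) at 2. apply (loc_mono CL m pm), mmul_le_r.
Qed.

(** Induction on [l]: the local factors at a new maximal element are met with the factors already
    built. Neither disturbs the other, since each contains a denominator at the other's maximal
    elements. *)
Lemma glued_factorization a1 a2 b (l : list L) :
  a1 ** a2 [<=] b -> b <> mzero ->
  exists b1 b2, a1 [<=] b1 /\ a2 [<=] b2 /\
    (forall m, maximal m -> In m l -> b1 ** b2 [<=] loc m b /\ b [<=] loc m (b1 ** b2)) /\
    (forall m, maximal m -> ~ In m l ->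
       exists s, compact s /\ ~ s [<=] m /\ s [<=] b1 /\ s [<=] b2).
Proof.
  intros H Nb. induction l as [|m0 l IH].
  { exists mone, mone. split; [apply mone_top |]. split; [apply mone_top |]. split; [easy |].
    intros m Mm _. exists mone. split; [apply (compact_one CL) |].
    split; [| split; apply mle_refl]. intros K. now apply (proj1 Mm), mle_one. }
  destruct IH as [b1 [b2 [H1 [H2 [Hin Hout]]]]].
  (* List entries that are repeated or not maximal change nothing. *)
  destruct (classic (maximal m0 /\ ~ In m0 l)) as [[M0 N0] | C].
  2:{ exists b1, b2. split; [exact H1 |]. split; [exact H2 |]. split.
      - intros m Mm [<- | K]; apply Hin; auto. apply NNPP. tauto.
      - intros m Mm K. apply Hout; auto. intros K'. apply K. now right. }
  destruct (local_factorization a1 a2 b m0 H Nb M0) as [c [d [Hc [Hd [cd1 [cd2 Hs]]]]]].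
  exists (mmeet b1 c), (mmeet b2 d).
  (* If [k [<=] x ** y], then [k ** (s ** s) [<=] (x ** s) ** (y ** s)], which is below the product
     of the meets; [s ** s] is an admissible denominator at [m]. *)
  assert (away : forall m x y x' y' s, maximal m -> compact s -> ~ s [<=] m ->
            s [<=] x' -> s [<=] y' -> b [<=] loc m (x ** y) ->
            b [<=] loc m (mmeet x x' ** mmeet y y')).
  { intros m x y x' y' s Mm Cs Ns sx sy Hb. assert (pm := maximal_prime m Mm).
    apply mle_trans with (1 := Hb), (loc_least CL m pm), (compact_le CL).
    intros k Ck Hk. apply (loc_intro m k (s ** s)); [exact Ck | now apply (compact_mul CL) | |].
    - now apply prime_mul.
    - apply mle_trans with (1 := mmul_mono _ _ _ _ Hk (mle_refl _ (s ** s))).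
      rewrite mmul_swap. apply mmul_mono; apply mmeet_greatest;
        (apply mmul_le_l || apply mle_trans with (1 := mmul_le_r _ _); assumption). }
  split; [now apply mmeet_greatest |]. split; [now apply mmeet_greatest |]. split.
  - intros m Mm Hm. destruct (classic (In m l)) as [K | K].
    + destruct (Hin m Mm K) as [K1 K2]. split.
      * apply mle_trans with (2 := K1), mmul_mono; apply mmeet_l.
      * destruct (Hs m Mm) as [s [Cs [Ns [sc sd]]]]; [now intros -> |].
        now apply (away m b1 b2 c d s).
    + destruct Hm as [<- | Hm]; [| contradiction]. split.
      * apply mle_trans with (2 := cd1), mmul_mono; apply mmeet_r.
      * destruct (Hout m0 Mm K) as [s [Cs [Ns [s1 s2]]]].
        assert (sym : forall x y, mmeet x y = mmeet y x).
        { intros x y. apply mle_antisym; apply mmeet_greatest; auto using mmeet_l, mmeet_r. }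
        rewrite (sym b1), (sym b2). now apply (away m0 c d b1 b2 s).
  - intros m Mm Hm.
    destruct (Hout m Mm) as [s [Cs [Ns [s1 s2]]]]; [intros K; apply Hm; now right |].
    destruct (Hs m Mm) as [t [Ct [Nt [tc td]]]]; [intros ->; apply Hm; now left |].
    exists (s ** t). split; [now apply (compact_mul CL) |].
    split; [now apply prime_mul; [apply maximal_prime | |] |].
    split; apply mmeet_greatest;
      (apply mle_trans with (1 := mmul_le_l _ _); assumption) ||
      (apply mle_trans with (1 := mmul_le_r _ _); assumption).
Qed.

Lemma sharp_of_localizations : finite_character L -> sharp L.
Proof.
  intros fc a1 a2 b H.
  (* Finite character says nothing about zero; there the domain hypothesis makes [a1] or [a2]
     zero. *)
  destruct (classic (b = mzero)) as [-> | Nb].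
  { destruct (mmul_eq0 dom a1 a2) as [-> | ->]; [now apply mle_zero | |].
    - exists mzero, mone. rewrite mmul_1r.
      split; [apply mle_refl |]. split; [apply mone_top | reflexivity].
    - exists mone, mzero. rewrite mmul_1l.
      split; [apply mone_top |]. split; [apply mle_refl | reflexivity]. }
  destruct (fc b Nb) as [l Hl].
  destruct (glued_factorization a1 a2 b l H Nb) as [b1 [b2 [H1 [H2 [Hin Hout]]]]].
  exists b1, b2. split; [exact H1 |]. split; [exact H2 |].
  (* Equality is checked at each maximal element. Outside [l], which contains all those above [b],
     both [b] and [b1 ** b2] localize to [mone]. *)
  apply mle_antisym; apply le_of_loc; intros m Mm;
    (destruct (classic (In m l)) as [K | K]; [now apply Hin |]).
  - destruct (Hout m Mm K) as [s [Cs [Ns [s1 s2]]]].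
    rewrite (loc_eq_one CL m (b1 ** b2)); [apply mone_top |]. intros C.
    apply (prime_mul m (maximal_prime m Mm) s s Ns Ns).
    apply mle_trans with (2 := C). now apply mmul_mono.
  - rewrite (loc_eq_one CL m b); [apply mone_top |]. intros C. now apply K, Hl.
Qed.

End Converse.

Theorem theorem3p12 (L : MultLattice) :
  C_lattice L ->
  is_domain L ->
  (forall x : L, exists S : L -> Prop,
      (forall a, S a -> principal a) /\ x = msup S) ->
  (exists x : L, x <> mzero /\ x <> mone) ->
  finite_character L ->
  (sharp L <->
   forall m : L, maximal m -> iso_Zminus m \/ iso_R1 m).
Proof.
  intros CL dom gen [x0 [Nx0 Nx1]] fc. split.
  - intros shp m Mm. apply (sharp_localization CL dom); auto using maximal_prime.
    + intros x. destruct (gen x) as [S [PS ->]]. exists S.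
      split; [intros a Sa; now apply principal_cprincipal, PS | reflexivity].
    (* If zero were maximal, the nontrivial [x0] would have to be zero or one. *)
    + intros ->. destruct (proj2 Mm x0 (mzero_bot _ x0)); contradiction.
  - intros iso. now apply sharp_of_localizations.
Qed.
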